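(* Let $\nu>-1$ and $\alpha\in[0,1)$. Then the radius of convexity of order $\alpha$, $r^c_\alpha(g_\nu)$, of the function $g_{\nu}(z)=2^{\nu}\Gamma(\nu+1)z^{1-\nu}J_{\nu}(z)$ is the smallest positive root of the equation $$1+r\,\frac{rJ_{\nu+2}(r)-3J_{\nu+1}(r)}{J_{\nu}(r)-rJ_{\nu+1}(r)}=\alpha.$$ Moreover, $r^c_{\alpha}(g_{\nu})<\alpha_{\nu,1}<j_{\nu,1}$, where $\alpha_{\nu,1}$ is the first positive zero of the Dini function $z\mapsto (1-\nu)J_\nu(z)+zJ'_\nu(z)$ and $j_{\nu,1}$ is the first positive zero of $J_\nu$.
   Context: $J_\nu$ is the Bessel function of the first kind, $J_{\nu}(z)=\sum_{n\geq0}\frac{(-1)^{n}}{n!\,\Gamma(n+\nu+1)}\left(\frac{z}{2}\right)^{2n+\nu}$. The function $g_\nu$ is entire: $g_{\nu}(z)=2^{\nu}\Gamma(\nu+1)z^{1-\nu}J_{\nu}(z)=z-\frac{1}{4(\nu+1)}z^3+\frac{1}{32(\nu+1)(\nu+2)}z^5-\dots$. For a function $f$ analytic near $0$ with $f'(0)\ne 0$, the radius of convexity of order $\alpha$ is $$r^c_\alpha(f)=\sup\left\{r\in(0,\infty)\,:\ \operatorname{Re}\left(1+\frac{zf''(z)}{f'(z)}\right)>\alpha\ \text{ for all } |z|<r\right\}$$ (the condition includes that $1+zf''(z)/f'(z)$ is defined and analytic in $|z|<r$). *)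

(* Defs.v *)
From Stdlib Require Import Reals Factorial.
From Coquelicot Require Export Coquelicot.

Local Open Scope R_scope.

(* Euler's integral; it converges, and hence is meaningful, exactly for 0 < x.
   For order nu > -1 only arguments n + nu + 1 > 0 occur below. *)
Definition Gamma (x : R) : R :=
  RInt_gen (fun t => Rpower t (x - 1) * exp (- t))
    (at_right 0) (Rbar_locally p_infty).

(* Principal argument, with values in (-PI, PI]. *)
Definition Carg (z : C) : R :=
  if Rle_dec 0 (Im z) then acos (Re z / Cmod z) else - acos (Re z / Cmod z).

Definition Clog (z : C) : C := (ln (Cmod z), Carg z).

Definition Cexp (z : C) : C := (exp (Re z) * cos (Im z), exp (Re z) * sin (Im z)).

(* Principal branch of z^a for real a. *)
Definition Cpower (z : C) (a : R) : C :=
  if Ceq_dec z 0 then (if Req_EM_T a 0 then 1 else 0)%C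
  else Cexp (a * Clog z)%C.

(* Meaningful when the series of real and imaginary parts both converge. *)
Definition CSeries (a : nat -> C) : C :=
  (Series (fun n => Re (a n)), Series (fun n => Im (a n))).

Definition bessel_J (nu : R) (z : C) : C :=
  CSeries (fun n =>
    RtoC ((-1) ^ n / (INR (fact n) * Gamma (INR n + nu + 1)))
    * Cpower (z / 2) (2 * INR n + nu))%C.

(* For z <> 0 the branches in z^(1-nu) and in bessel_J cancel, also on the cut,
   so this is single-valued; 0 is a removable singularity, filled in here. *)
Definition bessel_g (nu : R) (z : C) : C :=
  if Ceq_dec z 0 then RtoC 0
  else (RtoC (Rpower 2 nu * Gamma (nu + 1))
        * Cpower z (1 - nu) * bessel_J nu z)%C.

Definition dini (nu : R) (z : C) : C :=
  (RtoC (1 - nu) * bessel_J nu z + z * C_derive (bessel_J nu) z)%C.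

(* Complex differentiability at every point of the open disk, i.e. analyticity. *)
Definition analytic_on_disk (f : C -> C) (r : R) : Prop :=
  forall z : C, Cmod z < r -> ex_derive f z.

Definition convexity_quotient (f : C -> C) (z : C) : C :=
  (1 + z * C_derive (C_derive f) z / C_derive f z)%C.

(* C_derive and division are total, so the requirement that the quotient be
   defined and analytic on the disk is spelled out. *)
Definition convex_of_order_on_disk (alpha : R) (f : C -> C) (r : R) : Prop :=
  analytic_on_disk f r /\
  analytic_on_disk (C_derive f) r /\
  (forall z : C, Cmod z < r -> C_derive f z <> 0) /\
  analytic_on_disk (convexity_quotient f) r /\
  (forall z : C, Cmod z < r -> Re (convexity_quotient f z) > alpha).

Definition radius_of_convexity (alpha : R) (f : C -> C) : Rbar :=
  Lub_Rbar (fun r => 0 < r /\ convex_of_order_on_disk alpha f r).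

Definition smallest_positive (P : R -> Prop) (r : R) : Prop :=
  0 < r /\ P r /\ forall s : R, 0 < s -> P s -> r <= s.

(* A root must be a point where the left-hand side is defined. *)
Definition convexity_equation (nu alpha r : R) : Prop :=
  (bessel_J nu r - r * bessel_J (nu + 1) r <> 0)%C /\
  (1 + r * ((r * bessel_J (nu + 2) r - 3 * bessel_J (nu + 1) r)
            / (bessel_J nu r - r * bessel_J (nu + 1) r)) = alpha)%C.

(* Main.v *)
(* Put w = z^2 and g_nu(z) = z F(w); then g' = F + 2 w F' and z g'' = 6 w F' + 4 w^2 F''.
   The formal logarithmic derivative t = - F'/F satisfies the Riccati equation
   w t' + (nu + 1) t = w t^2 + 1/4, hence has nonnegative coefficients, and
   z g''/g' = - (2 w t + 4 (w t + w^2 t') / (1 - 2 w t)).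
   Taking absolute values, Re (1 + z g''/g') is minimal on the positive axis for given |z|.
   This replaces the Hadamard product over the zeros of g': no information about complex zeros
   is needed. The series t converges up to the first positive zero of F because its truncations are
   subsolutions of the Riccati equation; likewise 1/F has nonnegative coefficients and converges
   there, so F has no zeros in that disk. The inequalities between the first zeros are Rolle's
   theorem for z F(z^2) and for z g'(z). *)
Require Import Defs.
From Stdlib Require Import Reals.
From Coquelicot Require Import Coquelicot.
From Stdlib Require Import Factorial Lra Lia Psatz FunctionalExtensionality Classical_Prop.
From mathcomp Require Import ssreflect.

Local Open Scope R_scope.

(** * Euler's integral *)

(** The Riccati equation is Bessel's equation [w F'' + (nu + 1) F' + F / 4 = 0] divided by F. On
    coefficients it expresses (k + nu + 1) t_k through a convolution of earlier ones, and nu > -1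
    keeps the divisor positive from k = 0 on. Of the Gamma function only positivity and the
    functional equation enter. The obstacle is convergence: nothing is known in advance about the
    radius of t. Hence t and 1/F are built as mere coefficient sequences, the identities between
    them are proved by convolution, and they turn into statements about functions only after the
    truncations have been bounded on the real axis; since the coefficients are nonnegative, a bound
    at |w| gives absolute convergence at w. The same bound read backwards shows that F has a
    positive zero at all: t has a geometric minorant, so F cannot stay positive for ever. The order
    alpha enters through the ends of an interval: the quotient 1 + z g''/g' is 1 > alpha at the
    origin and 0 <= alpha at a zero of (z g')' that precedes the first zero of g'. *)

Definition gamma_integrand (x t : R) : R := Rpower t (x - 1) * exp (- t).

Lemma gamma_integrand_pos (x t : R) : 0 < gamma_integrand x t.
Proof. apply Rmult_lt_0_compat; apply exp_pos. Qed.

Lemma gamma_integrand_continuous (x t : R) : 0 < t -> continuous (gamma_integrand x) t.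
Proof.
  intros Ht. apply (ex_derive_continuous (gamma_integrand x)).
  unfold gamma_integrand, Rpower. auto_derive. exact Ht.
Qed.

Lemma gamma_integrand_ex_RInt (x a b : R) : 0 < a -> 0 < b ->
  ex_RInt (gamma_integrand x) a b.
Proof.
  intros Ha Hb. apply (ex_RInt_continuous (V := R_CompleteNormedModule)).
  intros z Hz. apply gamma_integrand_continuous.
  destruct Hz as [Hz _]. eapply Rlt_le_trans; [| exact Hz].
  apply Rmin_case; assumption.
Qed.

(** Half of the exponential absorbs the power: [1 + ln u <= u] at u = t / (2 p) gives p ln t <= t /
    2 + p ln (2 p). The exponent [p] is at least 1 so that it can be divided by, and at least x - 1,
    which suffices because ln t >= 0. *)
Lemma gamma_integrand_tail (x : R) :
  exists M, forall t, 1 <= t -> gamma_integrand x t <= M * exp (- (t / 2)).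
Proof.
  set (p := Rmax 1 (x - 1)).
  assert (Hp : 0 < p) by (unfold p; pose proof (Rmax_l 1 (x - 1)); lra).
  assert (Hxp : x - 1 <= p) by apply Rmax_r.
  exists (exp (p * ln (2 * p))). intros t Ht.
  unfold gamma_integrand, Rpower. rewrite <- !exp_plus.
  assert (Hln : 0 <= ln t) by (rewrite <- ln_1; apply ln_le; lra).
  assert (Hl : ln t <= t / (2 * p) + ln (2 * p)).
  { replace t with (t / (2 * p) * (2 * p)) at 1 by (field; lra).
    rewrite ln_mult; [| apply Rdiv_lt_0_compat; lra | lra].
    assert (0 < t / (2 * p)) by (apply Rdiv_lt_0_compat; lra).
    pose proof (exp_ineq1_le (ln (t / (2 * p)))).
    rewrite exp_ln in H0; [lra | assumption]. }
  apply Rnot_lt_le. intros Hlt. apply exp_lt_inv in Hlt.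
  assert ((x - 1) * ln t <= p * ln t) by (apply Rmult_le_compat_r; lra).
  assert (p * ln t <= p * (t / (2 * p) + ln (2 * p))) by (apply Rmult_le_compat_l; lra).
  replace (p * (t / (2 * p) + ln (2 * p))) with (t / 2 + p * ln (2 * p)) in H0 by (field; lra).
  lra.
Qed.

Lemma is_derive_Rpower (p t : R) : 0 < t ->
  is_derive (fun t => Rpower t p) t (p * Rpower t (p - 1)).
Proof.
  intros Ht. apply is_derive_Reals. apply derivable_pt_lim_power. exact Ht.
Qed.

Lemma Rpower_lim_0 (p : R) : 0 < p ->
  filterlim (fun t => Rpower t p) (at_right 0) (locally 0).
Proof.
  intros Hp. apply filterlim_locally. intros eps.
  assert (He : 0 < Rpower eps (/ p)) by apply exp_pos.
  exists (mkposreal _ He). intros t Ht Ht0.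
  rewrite /ball /= /AbsRing_ball /abs /minus /plus /opp /= in Ht |- *.
  rewrite !Ropp_0 !Rplus_0_r in Ht |- *.
  rewrite Rabs_right in Ht; [| lra].
  rewrite Rabs_right; [| left; apply exp_pos].
  replace (pos eps) with (Rpower (Rpower eps (/ p)) p).
  - apply Rlt_Rpower_l; lra.
  - rewrite Rpower_mult Rinv_l; [| lra]. apply Rpower_1, cond_pos.
Qed.

Lemma gamma_integrand_int_0 (x t : R) : 0 < x -> 0 < t <= 1 ->
  RInt (gamma_integrand x) t 1 <= / x.
Proof.
  intros Hx Ht.
  assert (Hi : is_RInt (fun t => Rpower t (x - 1)) t 1 (Rpower 1 x / x - Rpower t x / x)).
  { apply (is_RInt_derive (fun t => Rpower t x / x)).
    - intros s Hs. rewrite Rmin_left in Hs; [| lra].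
      replace (Rpower s (x - 1)) with (x * Rpower s (x - 1) / x) by (field; lra).
      apply (is_derive_ext (fun t => / x * Rpower t x)); [intros u; apply Rmult_comm |].
      replace (x * Rpower s (x - 1) / x) with (/ x * (x * Rpower s (x - 1))) by (field; lra).
      apply (is_derive_scal (fun t => Rpower t x)), is_derive_Rpower; lra.
    - intros s Hs. rewrite Rmin_left in Hs; [| lra].
      apply (ex_derive_continuous (fun t => Rpower t (x - 1))).
      eexists. apply is_derive_Rpower. lra. }
  apply Rle_trans with (RInt (fun t => Rpower t (x - 1)) t 1).
  - apply RInt_le; [lra | apply gamma_integrand_ex_RInt; lra | eexists; exact Hi |].
    intros s Hs. unfold gamma_integrand.
    rewrite <- (Rmult_1_r (Rpower s (x - 1))) at 2.
    apply Rmult_le_compat_l; [left; apply exp_pos |].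
    rewrite <- exp_0. left; apply exp_increasing; lra.
  - rewrite (is_RInt_unique _ _ _ _ Hi).
    unfold Rpower at 1. rewrite ln_1 Rmult_0_r exp_0.
    assert (0 < Rpower t x / x) by (apply Rdiv_lt_0_compat; [apply exp_pos | lra]).
    unfold Rdiv in *; lra.
Qed.

Lemma monotone_bounded_lim_infty (F : R -> R) (M : R) :
  (forall s t, 1 <= s <= t -> F s <= F t) -> (forall t, 1 <= t -> F t <= M) ->
  exists l, filterlim F (Rbar_locally p_infty) (locally l) /\ forall t, 1 <= t -> F t <= l.
Proof.
  intros Hm HM.
  destruct (completeness (fun y => exists t, 1 <= t /\ y = F t)) as [l [Hub Hl]].
  - exists M. intros y [t [Ht ->]]. auto.
  - exists (F 1), 1. split; [lra | reflexivity].
  - exists l. split.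
    + apply filterlim_locally. intros eps.
      assert (exists t, 1 <= t /\ l - eps < F t) as [t [Ht Hlt]].
      { apply NNPP. intros H.
        assert (l <= l - eps); [| pose proof (cond_pos eps); lra].
        apply Hl. intros y [t [Ht ->]]. apply Rnot_lt_le. intros H'. apply H. eauto. }
      exists t. intros s Hs.
      rewrite /ball /= /AbsRing_ball /abs /minus /plus /opp /=.
      assert (F t <= F s) by (apply Hm; lra).
      assert (F s <= l) by (apply Hub; exists s; split; [lra | reflexivity]).
      apply Rabs_def1; lra.
    + intros t Ht. apply Hub. eauto.
Qed.

Lemma gamma_right (x : R) : exists l,
  is_RInt_gen (gamma_integrand x) (at_point 1) (Rbar_locally p_infty) l /\ 0 < l.
Proof.
  destruct (gamma_integrand_tail x) as [M HM].
  set (F := fun t => RInt (gamma_integrand x) 1 t).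
  assert (Hmon : forall s t, 1 <= s <= t -> F s <= F t).
  { intros s t Hst. unfold F.
    rewrite <- (RInt_Chasles (gamma_integrand x) 1 s t); try (apply gamma_integrand_ex_RInt; lra).
    rewrite /plus /=.
    assert (0 <= RInt (gamma_integrand x) s t); [| lra].
    apply RInt_ge_0; [lra | apply gamma_integrand_ex_RInt; lra |].
    intros; left; apply gamma_integrand_pos. }
  destruct (monotone_bounded_lim_infty F (2 * M * exp (- (1 / 2)))) as [l [Hl Hle]].
  - exact Hmon.
  - intros t Ht. unfold F.
    assert (Hi : is_RInt (fun t => M * exp (- (t / 2))) 1 t
                   (- 2 * M * exp (- (t / 2)) - (- 2 * M * exp (- (1 / 2))))).
    { apply (is_RInt_derive (fun t => - 2 * M * exp (- (t / 2)))).
      - intros s _. auto_derive; [trivial |]. unfold Rdiv; field.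
      - intros s _. apply (ex_derive_continuous (fun t => M * exp (- (t / 2)))).
        auto_derive. trivial. }
    apply Rle_trans with (RInt (fun t => M * exp (- (t / 2))) 1 t).
    + apply RInt_le; [lra | apply gamma_integrand_ex_RInt; lra | eexists; exact Hi |].
      intros s Hs. apply HM. lra.
    + rewrite (is_RInt_unique _ _ _ _ Hi).
      assert (0 <= M).
      { specialize (HM 1 (Rle_refl 1)). pose proof (gamma_integrand_pos x 1).
        pose proof (exp_pos (- (1 / 2))). nra. }
      pose proof (exp_pos (- (t / 2))). nra.
  - exists l. split.
    + intros P HP. specialize (Hl P HP). unfold filtermapi, filtermap in *.
      exists (fun a => a = 1) (fun b => P (F b) /\ 1 < b); [reflexivity | |].
      * apply filter_and; [exact Hl | exists 1; auto].
      * intros a b -> [Hb Hb1]. exists (F b). split; [| exact Hb].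
        apply (RInt_correct (V := R_CompleteNormedModule)), gamma_integrand_ex_RInt;
          [exact Rlt_0_1 | exact (Rlt_trans _ _ _ Rlt_0_1 Hb1)].
    (* Strict positivity of [Gamma] is secured on this half of the integral: the piece over [1, 2]
       is already positive. *)
    + apply Rlt_le_trans with (F 2); [| apply Hle; lra].
      apply RInt_gt_0; [lra | |].
      * intros; apply gamma_integrand_pos.
      * intros; apply gamma_integrand_continuous; lra.
Qed.

Lemma gamma_left (x : R) : 0 < x -> exists l,
  is_RInt_gen (gamma_integrand x) (at_right 0) (at_point 1) l /\ 0 <= l.
Proof.
  intros Hx.
  (* Inverting the lower endpoint turns the limit at 0 into a monotone limit at infinity. *)
  set (F := fun t => RInt (gamma_integrand x) (/ t) 1).
  assert (Hinv : forall t, 1 <= t -> 0 < / t <= 1).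
  { intros t Ht. split; [apply Rinv_0_lt_compat; lra |].
    rewrite <- Rinv_1. apply Rinv_le_contravar; lra. }
  destruct (monotone_bounded_lim_infty F (/ x)) as [l [Hl Hle]].
  - intros s t Hst. unfold F.
    pose proof (Hinv s ltac:(lra)). pose proof (Hinv t ltac:(lra)).
    assert (/ t <= / s) by (apply Rinv_le_contravar; lra).
    rewrite <- (RInt_Chasles (gamma_integrand x) (/ t) (/ s) 1);
      try (apply gamma_integrand_ex_RInt; lra).
    rewrite /plus /=.
    assert (0 <= RInt (gamma_integrand x) (/ t) (/ s)); [| lra].
    apply RInt_ge_0; [lra | apply gamma_integrand_ex_RInt; lra |].
    intros; left; apply gamma_integrand_pos.
  - intros t Ht. apply gamma_integrand_int_0; auto.
  - exists l. split.
    + intros P HP. destruct (Hl P HP) as [M HM]. unfold filtermapi.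
      set (K := Rmax 1 M).
      assert (HK : 0 < / (K + 1)) by (apply Rinv_0_lt_compat; unfold K; pose proof (Rmax_l 1 M); lra).
      exists (fun a => 0 < a < / (K + 1)) (fun b => b = 1); [| reflexivity |].
      * exists (mkposreal _ HK). intros t Ht Ht0.
        rewrite /ball /= /AbsRing_ball /abs /minus /plus /opp /= in Ht.
        apply Rabs_def2 in Ht. lra.
      * intros a b Ha ->.
        exists (F (/ a)). split.
        -- unfold F. rewrite /= Rinv_inv. apply (RInt_correct (V := R_CompleteNormedModule)), gamma_integrand_ex_RInt; lra.
        -- apply HM. apply Rle_lt_trans with K; [apply Rmax_r |].
           apply Rlt_trans with (K + 1); [lra |].
           rewrite <- (Rinv_inv (K + 1)). apply Rinv_lt_contravar; [| lra].
           apply Rmult_lt_0_compat; lra.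
    + specialize (Hle 1 (Rle_refl 1)). unfold F in Hle.
      rewrite Rinv_1 RInt_point in Hle. exact Hle.
Qed.

Lemma Gamma_correct (x : R) : 0 < x ->
  is_RInt_gen (gamma_integrand x) (at_right 0) (Rbar_locally p_infty) (Gamma x).
Proof.
  intros Hx. apply (RInt_gen_correct (V := R_CompleteNormedModule)).
  destruct (gamma_left x Hx) as [l1 [H1 _]], (gamma_right x) as [l2 [H2 _]].
  exists (plus l1 l2). exact (is_RInt_gen_Chasles _ 1 _ _ H1 H2).
Qed.

Lemma Gamma_pos (x : R) : 0 < x -> 0 < Gamma x.
Proof.
  intros Hx.
  destruct (gamma_left x Hx) as [l1 [H1 Hl1]], (gamma_right x) as [l2 [H2 Hl2]].
  unfold Gamma.
  rewrite (is_RInt_gen_unique _ _ (is_RInt_gen_Chasles _ 1 _ _ H1 H2)).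
  rewrite /plus /=. lra.
Qed.

Lemma gamma_integrand_lim_0 (x : R) : 0 < x ->
  filterlim (gamma_integrand (x + 1)) (at_right 0) (locally 0).
Proof.
  intros Hx. apply (filterlim_le_le (F := at_right 0)
    (fun _ => 0) _ (fun t => Rpower t x) (Finite 0)).
  - exists (mkposreal 1 Rlt_0_1). intros t _ Ht. split; [left; apply gamma_integrand_pos |].
    unfold gamma_integrand. replace (x + 1 - 1) with x by ring.
    rewrite <- (Rmult_1_r (Rpower t x)) at 2.
    apply Rmult_le_compat_l; [left; apply exp_pos |].
    rewrite <- exp_0. left; apply exp_increasing; lra.
  - apply filterlim_const.
  - apply Rpower_lim_0, Hx.
Qed.

Lemma gamma_integrand_lim_infty (x : R) :
  filterlim (gamma_integrand x) (Rbar_locally p_infty) (locally 0).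
Proof.
  destruct (gamma_integrand_tail x) as [M HM].
  apply (filterlim_le_le (F := Rbar_locally p_infty)
    (fun _ => 0) _ (fun t => M * exp (- (t / 2))) (Finite 0)).
  - exists 1. intros t Ht. split; [left; apply gamma_integrand_pos | apply HM; lra].
  - apply filterlim_const.
  - assert (H : is_lim (fun t => M * exp (- (t / 2))) p_infty (M * 0)).
    { apply (is_lim_scal_l (fun t => exp (- (t / 2))) M p_infty (Finite 0)).
      apply (is_lim_comp exp (fun t => - (t / 2)) p_infty (Finite 0) m_infty).
      - apply is_lim_exp_m.
      - apply (is_lim_ext (fun t => (- / 2) * t)); [intros; field |].
        replace m_infty with (Rbar_mult (- / 2) p_infty).
        + apply is_lim_scal_l, is_lim_id.
        + apply is_Rbar_mult_unique, is_Rbar_mult_sym, is_Rbar_mult_p_infty_neg. simpl. lra.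
      - exists 0. intros; discriminate. }
    rewrite Rmult_0_r in H. exact H.
Qed.

(** Integration by parts: the integral of the derivative of t^x exp(-t) over (0, oo) is 0 by its
    boundary limits, and x Gamma(x) - Gamma(x + 1) by linearity. *)
Lemma Gamma_succ (x : R) : 0 < x -> Gamma (x + 1) = x * Gamma x.
Proof.
  intros Hx.
  set (f := gamma_integrand (x + 1)).
  assert (Hd : forall t, 0 < t -> is_derive f t (x * gamma_integrand x t - f t)).
  { intros t Ht. unfold f, gamma_integrand. replace (x + 1 - 1) with x by ring.
    replace (x * (Rpower t (x - 1) * exp (- t)) - Rpower t x * exp (- t))
      with (x * Rpower t (x - 1) * exp (- t) + Rpower t x * (- exp (- t))) by ring.
    apply (is_derive_mult (K := R_AbsRing) (fun t => Rpower t x) (fun t => exp (- t))).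
    - apply is_derive_Rpower, Ht.
    - auto_derive; [trivial | ring].
    - exact Rmult_comm. }
  assert (Hpos : forall (P : R -> Prop), (forall t, 0 < t -> P t) ->
    filter_prod (at_right 0) (Rbar_locally p_infty)
      (fun ab => forall t, Rmin (fst ab) (snd ab) <= t <= Rmax (fst ab) (snd ab) -> P t)).
  { intros P HP. exists (fun a => 0 < a) (fun b => 0 < b).
    - exists (mkposreal 1 Rlt_0_1). intros t _ Ht; exact Ht.
    - exists 0. auto.
    - intros a b Ha Hb t [Ht _]. apply HP. eapply Rlt_le_trans; [| exact Ht].
      simpl. apply Rmin_case; assumption. }
  assert (HD : is_RInt_gen (Derive f) (at_right 0) (Rbar_locally p_infty) (0 - 0)).
  { apply is_RInt_gen_Derive.
    - apply Hpos. intros t Ht. eexists. apply Hd, Ht.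
    - apply Hpos. intros t Ht.
      apply (continuous_ext_loc _ (fun t => x * gamma_integrand x t - f t)).
      + exists (mkposreal t Ht). intros s Hs.
        rewrite /ball /= /AbsRing_ball /abs /minus /plus /opp /= in Hs.
        apply Rabs_def2 in Hs. symmetry. apply is_derive_unique, Hd. lra.
      + apply (continuous_minus (V := R_NormedModule)).
        * apply (continuous_scal_r x (gamma_integrand x)), gamma_integrand_continuous, Ht.
        * apply gamma_integrand_continuous, Ht.
    - apply gamma_integrand_lim_0, Hx.
    - apply gamma_integrand_lim_infty. }
  assert (HG : is_RInt_gen (Derive f) (at_right 0) (Rbar_locally p_infty)
                 (minus (scal x (Gamma x)) (Gamma (x + 1)))).
  { apply (is_RInt_gen_ext (V := R_NormedModule) (fun t => minus (scal x (gamma_integrand x t)) (f t))).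
    - apply (filter_imp (fun ab => forall t, Rmin (fst ab) (snd ab) <= t <= Rmax (fst ab) (snd ab) ->
        minus (scal x (gamma_integrand x t)) (f t) = Derive f t)).
      + intros ab H t Ht. apply H. lra.
      + apply Hpos. intros t Ht. symmetry. apply is_derive_unique. exact (Hd t Ht).
    - apply (is_RInt_gen_minus (V := R_NormedModule) (fun t => scal x (gamma_integrand x t)) f).
      + apply (is_RInt_gen_scal (V := R_NormedModule) (gamma_integrand x)). apply Gamma_correct, Hx.
      + apply Gamma_correct. lra. }
  pose proof (is_RInt_gen_unique _ _ HD) as E1.
  rewrite (is_RInt_gen_unique _ _ HG) in E1.
  rewrite /minus /plus /opp /scal /= /mult /= in E1. lra.
Qed.

(** * Formal power series *)

Lemma PS_mult_ext_le (a a' b b' : nat -> R) (n : nat) :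
  (forall k, (k <= n)%nat -> a k = a' k) -> (forall k, (k <= n)%nat -> b k = b' k) ->
  PS_mult a b n = PS_mult a' b' n.
Proof.
  intros Ha Hb. apply sum_eq. intros i Hi. rewrite Ha; [| lia]. rewrite Hb; [reflexivity | lia].
Qed.

Lemma PS_mult_S_l (a b : nat -> R) (n : nat) :
  PS_mult a b (S n) = a O * b (S n) + PS_mult (fun k => a (S k)) b n.
Proof.
  unfold PS_mult. rewrite decomp_sum; [| lia]. f_equal.
Qed.

Lemma PS_mult_S_r (a b : nat -> R) (n : nat) :
  PS_mult a b (S n) = PS_mult a (fun k => b (S k)) n + a (S n) * b O.
Proof.
  unfold PS_mult. rewrite tech5. f_equal.
  - apply sum_eq. intros i Hi. f_equal. f_equal. lia.
  - rewrite Nat.sub_diag. reflexivity.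
Qed.

Lemma PS_mult_comm (a b : nat -> R) (n : nat) : PS_mult a b n = PS_mult b a n.
Proof.
  revert a b. induction n as [| n IH]; intros a b.
  - unfold PS_mult; simpl; ring.
  - rewrite PS_mult_S_l PS_mult_S_r IH. ring.
Qed.

Lemma PS_mult_linear_l (c : R) (a a' b : nat -> R) (n : nat) :
  PS_mult (fun k => c * a k + a' k) b n = c * PS_mult a b n + PS_mult a' b n.
Proof.
  unfold PS_mult. rewrite scal_sum -sum_plus. apply sum_eq. intros; ring.
Qed.

Lemma PS_mult_assoc (a b c : nat -> R) (n : nat) :
  PS_mult (PS_mult a b) c n = PS_mult a (PS_mult b c) n.
Proof.
  revert a. induction n as [| n IH]; intros a.
  - unfold PS_mult; simpl; ring.
  - rewrite !(PS_mult_S_l _ _ n).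
    rewrite (PS_mult_ext_le (fun k => PS_mult a b (S k))
      (fun k => a O * b (S k) + PS_mult (fun k => a (S k)) b k) c c n);
      [| intros; apply PS_mult_S_l | reflexivity].
    rewrite PS_mult_linear_l IH. unfold PS_mult at 1. simpl. ring.
Qed.

(** Inside the convolution the factor n + 1 splits as i + (n + 1 - i). *)
Lemma PS_derive_mult (a b : nat -> R) (n : nat) :
  PS_derive (PS_mult a b) n = PS_mult (PS_derive a) b n + PS_mult a (PS_derive b) n.
Proof.
  transitivity (PS_mult (fun k => INR k * a k) b (S n) + PS_mult a (fun k => INR k * b k) (S n)).
  - unfold PS_derive, PS_mult. rewrite scal_sum -sum_plus.
    apply sum_eq. intros i Hi. rewrite minus_INR; [ring | lia].
  - rewrite PS_mult_S_l PS_mult_S_r. unfold PS_derive. simpl INR. ring.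
Qed.

(** The left side sums over the triangle i + j <= n, the right side over the square that contains
    it. *)
Lemma sum_PS_mult_le (a b : nat -> R) (n : nat) :
  (forall k, 0 <= a k) -> (forall k, 0 <= b k) ->
  sum_f_R0 (PS_mult a b) n <= sum_f_R0 a n * sum_f_R0 b n.
Proof.
  intros Ha Hb. revert a Ha. induction n as [| n IH]; intros a Ha.
  - simpl. unfold PS_mult. simpl. lra.
  - assert (E : sum_f_R0 (PS_mult a b) (S n) =
      a O * sum_f_R0 b (S n) + sum_f_R0 (PS_mult (fun k => a (S k)) b) n).
    { rewrite (decomp_sum _ (S n)); [| lia]. rewrite (decomp_sum b (S n)); [| lia]. simpl pred.
      rewrite (sum_eq (fun i => PS_mult a b (S i))
        (fun i => b (S i) * a O + PS_mult (fun k => a (S k)) b i) n).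
      - rewrite sum_plus -scal_sum. unfold PS_mult at 1. simpl. ring.
      - intros i _. rewrite PS_mult_S_l. ring. }
    rewrite E. specialize (IH (fun k => a (S k)) (fun k => Ha (S k))).
    rewrite (decomp_sum a (S n)); [| lia]. simpl pred.
    rewrite tech5. pose proof (Hb (S n)).
    assert (0 <= sum_f_R0 (fun k => a (S k)) n) by (apply cond_pos_sum; auto).
    nra.
Qed.

Lemma PS_mult_weight (a b : nat -> R) (x : R) (n : nat) :
  PS_mult a b n * x ^ n = PS_mult (fun k => a k * x ^ k) (fun k => b k * x ^ k) n.
Proof.
  unfold PS_mult. rewrite Rmult_comm scal_sum. apply sum_eq. intros i Hi.
  replace n with (i + (n - i))%nat at 2 by lia. rewrite pow_add. ring.
Qed.

(** Iterating [F] from the zero sequence gives [u n], which has its final values at all indices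
    below n; the solution is read off the diagonal. *)
Lemma strong_recursion (F : nat -> (nat -> R) -> R) :
  (forall k s s', (forall i, (i < k)%nat -> s i = s' i) -> F k s = F k s') ->
  exists s, forall k, s k = F k s.
Proof.
  intros HF.
  set (u := fix u n := match n with O => fun _ => 0 | S n => fun k => F k (u n) end).
  assert (H : forall n m k, (k < n)%nat -> (k < m)%nat -> u n k = u m k).
  { induction n as [| n IH]; intros m k Hn Hm; [lia |].
    destruct m as [| m]; [lia |]. simpl. apply HF. intros i Hi. apply IH; lia. }
  exists (fun k => u (S k) k). intros k. simpl. apply HF.
  intros i Hi. apply (H k (S i)); lia.
Qed.

(** * Formal solution of the Riccati equation, and the reciprocal series *)

Section Formal.

Variables (mu : R) (a : nat -> R).
Hypothesis Hmu : 0 < mu.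
Hypothesis Ha0 : a O = 1.
Hypothesis Harec : forall n, INR (S n) * (INR n + mu) * a (S n) = - a n / 4.

(** The coefficient of w^k in w t' + mu t = w t^2 + 1/4, where mu stands for nu + 1. *)
Definition riccati (t : nat -> R) : Prop :=
  forall k, (INR k + mu) * t k = match k with O => / 4 | S m => PS_mult t t m end.

Lemma ex_riccati : exists t, riccati t.
Proof.
  destruct (strong_recursion (fun k t =>
    match k with O => / 4 | S m => PS_mult t t m end / (INR k + mu))) as [t Ht].
  - intros [| k] s s' H; [reflexivity |]. f_equal.
    apply PS_mult_ext_le; intros; apply H; lia.
  - exists t. intros k. rewrite {1}Ht. field. pose proof (pos_INR k). lra.
Qed.

Variable t : nat -> R.
Hypothesis Ht : riccati t.

(** The constants are t_0 = 1 / (4 mu) and the ratio r = t_1 / t_0 = t_0 / (1 + mu). If the bound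
    holds below m + 1, the convolution has m + 1 terms, each at least t_0^2 r^m, and the step
    reduces to m + 1 + mu <= (m + 1) (1 + mu). The bound limits how far t can converge. *)
Lemma riccati_lower (k : nat) : / (4 * mu) * (/ (4 * mu * (1 + mu))) ^ k <= t k.
Proof.
  set (c := / (4 * mu)). set (r := / (4 * mu * (1 + mu))).
  assert (Hc : 0 < c) by (apply Rinv_0_lt_compat; lra).
  assert (Hr : 0 < r) by (apply Rinv_0_lt_compat; nra).
  assert (Hcr : c = (1 + mu) * r) by (unfold c, r; field; lra).
  induction k as [k IH] using (well_founded_induction Wf_nat.lt_wf).
  pose proof (Ht k) as Hk. destruct k as [| m].
  - simpl in *. assert (t O = c); [| lra].
    unfold c. apply (Rmult_eq_reg_l mu); [| lra]. rewrite Rplus_0_l in Hk. rewrite Hk. field. lra.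
  - assert (Hs : INR (S m) * (c * c * r ^ m) <= PS_mult t t m).
    { rewrite S_INR. replace ((INR m + 1) * (c * c * r ^ m))
        with (sum_f_R0 (fun _ => c * c * r ^ m) m) by (rewrite sum_cte S_INR; ring).
      apply sum_Rle. intros i Hi.
      replace (r ^ m) with (r ^ i * r ^ (m - i)) by (rewrite -pow_add; f_equal; lia).
      replace (c * c * (r ^ i * r ^ (m - i))) with ((c * r ^ i) * (c * r ^ (m - i))) by ring.
      assert (forall j, 0 <= c * r ^ j) by (intros; apply Rmult_le_pos; [lra | left; apply pow_lt, Hr]).
      apply Rmult_le_compat; auto; apply IH; lia. }
    rewrite -Hk in Hs. pose proof (pos_INR m). rewrite S_INR in Hs Hk *.
    apply (Rmult_le_reg_l (INR m + 1 + mu)); [lra |].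
    eapply Rle_trans; [| exact Hs]. simpl.
    replace ((INR m + 1 + mu) * (c * (r * r ^ m))) with ((INR m + 1 + mu) * r * (c * r ^ m)) by ring.
    replace ((INR m + 1) * (c * c * r ^ m)) with ((INR m + 1) * c * (c * r ^ m)) by ring.
    apply Rmult_le_compat_r; [apply Rmult_le_pos; [lra | left; apply pow_lt, Hr] |].
    rewrite Hcr. assert (0 <= INR m * mu * r) by (repeat apply Rmult_le_pos; lra). nra.
Qed.

Lemma riccati_nonneg (k : nat) : 0 <= t k.
Proof.
  eapply Rle_trans; [| apply riccati_lower].
  apply Rmult_le_pos; [left; apply Rinv_0_lt_compat; lra |].
  apply pow_le; left; apply Rinv_0_lt_compat; nra.
Qed.

(* P = a' + t a satisfies w P' + mu P = w t P, which forces P = 0 since k + mu > 0. *)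
Lemma log_derivative (k : nat) : PS_derive a k = - PS_mult t a k.
Proof.
  set (P := fun k => PS_derive a k + PS_mult t a k).
  assert (HP : forall k, (INR k + mu) * P k = match k with O => 0 | S m => PS_mult t P m end).
  { intros [| m].
    - unfold P, PS_derive, PS_mult. simpl. pose proof (Harec O) as H0. pose proof (Ht O) as H1.
      simpl in H0, H1. rewrite Ha0 in H0 *. nra.
    - assert (EP : PS_mult t P m = PS_mult t (PS_derive a) m + PS_mult (PS_mult t t) a m).
      { rewrite PS_mult_comm.
        rewrite (PS_mult_ext_le P (fun k => 1 * PS_derive a k + PS_mult t a k) t t m);
          [| intros; unfold P; ring | reflexivity].
        rewrite PS_mult_linear_l (PS_mult_comm _ t) (PS_mult_comm (PS_mult t a) t).
        rewrite (PS_mult_assoc t t a). ring. }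
      rewrite EP. unfold P.
      pose proof (PS_derive_mult t a m) as HD. unfold PS_derive at 1 in HD.
      rewrite Rmult_plus_distr_l (Rmult_plus_distr_r (INR (S m)) mu (PS_mult _ _ _)) HD.
      assert (E : PS_mult (PS_derive t) a m + mu * PS_mult t a (S m) =
        PS_mult (PS_mult t t) a m + a (S m) / 4).
      { pose proof (Ht O) as H1. simpl in H1. rewrite Rplus_0_l in H1.
        rewrite PS_mult_S_l.
        replace (mu * (t O * a (S m) + PS_mult (fun k => t (S k)) a m))
          with (mu * PS_mult (fun k => t (S k)) a m + mu * t O * a (S m)) by ring.
        rewrite H1.
        rewrite (PS_mult_ext_le (PS_mult t t) (fun k => mu * t (S k) + PS_derive t k) a a m);
          [| intros i _; transitivity ((INR (S i) + mu) * t (S i));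
             [symmetry; exact (Ht (S i)) | unfold PS_derive; ring]
           | reflexivity].
        rewrite PS_mult_linear_l. field. }
      pose proof (Harec (S m)) as H2.
      assert (E2 : (INR (S m) + mu) * PS_derive a (S m) = - a (S m) / 4).
      { rewrite -H2. unfold PS_derive. ring. }
      rewrite E2. lra. }
  assert (P k = 0) as HPk; [| unfold P in HPk; lra].
  induction k as [k IH] using (well_founded_induction Wf_nat.lt_wf).
  pose proof (HP k) as Hk. pose proof (pos_INR k).
  apply (Rmult_eq_reg_l (INR k + mu)); [| lra]. rewrite Hk Rmult_0_r.
  destruct k as [| m]; [reflexivity |].
  rewrite (PS_mult_ext_le t t P (fun _ => 0) m); [| reflexivity | intros; apply IH; lia].
  unfold PS_mult. apply sum_eq_R0. intros; ring.
Qed.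

(** The series of 1/F, given by the equation b' = t b instead of as a convolution inverse of [a]:
    the signs of [a] alternate, whereas this recursion passes nonnegativity from t to b. *)
Definition inverse_series (b : nat -> R) : Prop :=
  b O = 1 /\ forall k, PS_derive b k = PS_mult t b k.

Lemma ex_inverse_series : exists b, inverse_series b.
Proof.
  destruct (strong_recursion (fun k b =>
    match k with O => 1 | S m => PS_mult t b m / INR (S m) end)) as [b Hb].
  - intros [| k] s s' H; [reflexivity |]. f_equal.
    apply PS_mult_ext_le; intros; [reflexivity | apply H; lia].
  - exists b. split; [apply Hb |]. intros k. unfold PS_derive. rewrite (Hb (S k)).
    field. apply not_0_INR. lia.
Qed.

Variable b : nat -> R.
Hypothesis Hb : inverse_series b.

Lemma inverse_series_nonneg (k : nat) : 0 <= b k.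
Proof.
  induction k as [k IH] using (well_founded_induction Wf_nat.lt_wf).
  destruct Hb as [H0 H]. destruct k as [| m]; [rewrite H0; lra |].
  specialize (H m). unfold PS_derive in H.
  apply (Rmult_le_reg_l (INR (S m))); [apply lt_0_INR; lia |].
  rewrite Rmult_0_r H. unfold PS_mult.
  replace 0 with (sum_f_R0 (fun _ => 0) m) by (rewrite sum_cte; ring).
  apply sum_Rle. intros i Hi. apply Rmult_le_pos; [apply riccati_nonneg | apply IH; lia].
Qed.

(** The formal derivative of a b is - t a b + a t b = 0, so only the constant term survives. *)
Lemma inverse_series_spec (k : nat) : PS_mult a b k = match k with O => 1 | _ => 0 end.
Proof.
  destruct Hb as [H0 H]. destruct k as [| m].
  - unfold PS_mult; simpl. rewrite Ha0 H0. ring.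
  - apply (Rmult_eq_reg_l (INR (S m))); [| apply not_0_INR; lia].
    rewrite Rmult_0_r. change (PS_derive (PS_mult a b) m = 0). rewrite PS_derive_mult.
    rewrite (PS_mult_ext_le _ (fun k => (-1) * PS_mult t a k + 0) b b m);
      [| intros; rewrite log_derivative; ring | reflexivity].
    rewrite PS_mult_linear_l.
    rewrite (PS_mult_ext_le a a (PS_derive b) (PS_mult t b) m); [| reflexivity | auto].
    rewrite -(PS_mult_assoc a t b).
    rewrite (PS_mult_ext_le (PS_mult a t) (PS_mult t a) b b m);
      [| intros; apply PS_mult_comm | reflexivity].
    replace (PS_mult (fun _ => 0) b m) with 0; [ring |].
    symmetry. apply sum_eq_R0. intros; ring.
Qed.

Lemma log_derivative_2 (k : nat) :
  PS_derive (PS_derive a) k = - (PS_mult (PS_derive t) a k + PS_mult t (PS_derive a) k).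
Proof.
  rewrite -PS_derive_mult. unfold PS_derive at 1 3. rewrite log_derivative. ring.
Qed.

End Formal.

(** * Complex power series with real coefficients *)

Lemma is_series_nonneg (u : nat -> R) (l : R) :
  (forall n, 0 <= u n) -> is_series u l -> 0 <= l.
Proof.
  intros Hu Hl.
  apply (is_lim_seq_le (fun _ => 0) (sum_n u) (Finite 0) (Finite l)).
  - intros n. rewrite sum_n_Reals. apply cond_pos_sum, Hu.
  - apply is_lim_seq_const.
  - exact Hl.
Qed.

Lemma ex_series_dominated (u v : nat -> R) :
  (forall n, Rabs (u n) <= v n) -> ex_series v -> ex_series (fun n => Rabs (u n)).
Proof.
  intros H. apply (ex_series_le (K := R_AbsRing) (V := R_CompleteNormedModule)).
  intros n. rewrite /norm /= /abs /= Rabs_Rabsolu. apply H.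
Qed.

Lemma bounded_sum_ex_series (u : nat -> R) (M : R) :
  (forall n, 0 <= u n) -> (forall n, sum_f_R0 u n <= M) -> ex_series u.
Proof.
  intros Hu HM.
  destruct (ex_finite_lim_seq_incr (sum_n u) M) as [l Hl].
  - intros n. rewrite sum_Sn /plus /=. specialize (Hu (S n)). lra.
  - intros n. rewrite sum_n_Reals. apply HM.
  - exists l. exact Hl.
Qed.

Definition is_Cseries (u : nat -> C) (l : C) : Prop :=
  is_series (fun n => Re (u n)) (Re l) /\ is_series (fun n => Im (u n)) (Im l).

Lemma is_Cseries_unique (u : nat -> C) (l : C) : is_Cseries u l -> CSeries u = l.
Proof.
  intros [H1 H2]. unfold CSeries.
  rewrite (is_series_unique _ _ H1) (is_series_unique _ _ H2). destruct l; reflexivity.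
Qed.

Lemma is_Cseries_ext (u v : nat -> C) (l : C) :
  (forall n, u n = v n) -> is_Cseries u l -> is_Cseries v l.
Proof. intros H. replace v with u; [auto |]. apply functional_extensionality, H. Qed.

Lemma Re_le_Cmod (z : C) : Rabs (Re z) <= Cmod z.
Proof. eapply Rle_trans; [apply Rmax_l | apply Rmax_Cmod]. Qed.

Lemma Im_le_Cmod (z : C) : Rabs (Im z) <= Cmod z.
Proof. eapply Rle_trans; [apply Rmax_r | apply Rmax_Cmod]. Qed.

Lemma is_Cseries_abs (u : nat -> C) :
  ex_series (fun n => Cmod (u n)) -> is_Cseries u (CSeries u).
Proof.
  intros H. split; apply Series_correct, ex_series_Rabs;
    eapply ex_series_dominated; try exact H; intros n; [apply Re_le_Cmod | apply Im_le_Cmod].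
Qed.

Lemma is_Cseries_plus (u v : nat -> C) (l m : C) :
  is_Cseries u l -> is_Cseries v m -> is_Cseries (fun n => u n + v n)%C (l + m)%C.
Proof.
  intros [H1 H2] [H3 H4]. split; apply (is_series_plus (V := R_NormedModule)); assumption.
Qed.

Lemma is_Cseries_scal (c : C) (u : nat -> C) (l : C) :
  is_Cseries u l -> is_Cseries (fun n => c * u n)%C (c * l)%C.
Proof.
  intros [H1 H2]. split.
  - apply (is_series_minus (V := R_NormedModule) (fun n => Re c * Re (u n)) (fun n => Im c * Im (u n)));
      apply (is_series_scal (V := R_NormedModule)); assumption.
  - apply (is_series_plus (V := R_NormedModule) (fun n => Re c * Im (u n)) (fun n => Im c * Re (u n)));
      apply (is_series_scal (V := R_NormedModule)); assumption.
Qed.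

Lemma is_Cseries_decr_1 (u : nat -> C) (l : C) :
  u O = RtoC 0 -> is_Cseries (fun n => u (S n)) l -> is_Cseries u l.
Proof.
  intros H0 [H1 H2]. split; apply is_series_decr_1; rewrite H0.
  - replace (plus _ _) with (Re l); [exact H1 |].
    rewrite /plus /opp /=. ring.
  - replace (plus _ _) with (Im l); [exact H2 |].
    rewrite /plus /opp /=. ring.
Qed.

Lemma Cmod_sqr_Re (l : C) : Cmod l * Cmod l = Re (Cconj l * l)%C.
Proof.
  pose proof (Cmod2_conj l) as H. rewrite Cmult_comm -H.
  rewrite re_RtoC. ring.
Qed.

(** Multiplying by the conjugate of l rotates the sum onto the real axis: |l|^2 is the sum of Re
    (conj l u_n), and each term is at most |l| v_n. If l = 0, the claim is L >= 0. *)
Lemma is_Cseries_norm (u : nat -> C) (v : nat -> R) (l : C) (L : R) :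
  (forall n, Cmod (u n) <= v n) -> is_Cseries u l -> is_series v L -> Cmod l <= L.
Proof.
  intros Hle Hu Hv.
  assert (HL : 0 <= L).
  { apply (is_series_nonneg v); [| exact Hv]. intros n.
    eapply Rle_trans; [apply Cmod_ge_0 | apply Hle]. }
  destruct (is_Cseries_scal (Cconj l) u l Hu) as [H _].
  assert (H' : is_series (fun n => Cmod l * v n - Re (Cconj l * u n)%C) (Cmod l * L - Cmod l * Cmod l)).
  { rewrite (Cmod_sqr_Re l).
    apply (is_series_minus (V := R_NormedModule) (fun n => Cmod l * v n)); [| exact H].
    apply (is_series_scal (V := R_NormedModule)), Hv. }
  apply is_series_nonneg in H'.
  - destruct (Cmod_ge_0 l) as [Hl | Hl]; [| lra].
    apply (Rmult_le_reg_l (Cmod l)); lra.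
  - intros n. pose proof (Re_le_Cmod (Cconj l * u n)) as H1.
    pose proof (Rle_abs (Re (Cconj l * u n)%C)) as H2.
    rewrite Cmod_mult Cmod_conj in H1.
    assert (Cmod l * Cmod (u n) <= Cmod l * v n) by (apply Rmult_le_compat_l; [apply Cmod_ge_0 | apply Hle]).
    lra.
Qed.

Lemma is_Cseries_mult (u v : nat -> C) (l m : C) :
  is_Cseries u l -> is_Cseries v m ->
  ex_series (fun n => Cmod (u n)) -> ex_series (fun n => Cmod (v n)) ->
  is_Cseries (fun n =>
    (sum_f_R0 (fun k => Re (u k * v (n - k)%nat)%C) n,
     sum_f_R0 (fun k => Im (u k * v (n - k)%nat)%C) n)) (l * m)%C.
Proof.
  intros [U1 U2] [V1 V2] HU HV.
  assert (A1 := ex_series_dominated _ _ (fun n => Re_le_Cmod (u n)) HU).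
  assert (A2 := ex_series_dominated _ _ (fun n => Im_le_Cmod (u n)) HU).
  assert (B1 := ex_series_dominated _ _ (fun n => Re_le_Cmod (v n)) HV).
  assert (B2 := ex_series_dominated _ _ (fun n => Im_le_Cmod (v n)) HV).
  split.
  - eapply is_series_ext; [| apply (is_series_minus (V := R_NormedModule) _ _ _ _
      (is_series_mult _ _ _ _ U1 V1 A1 B1) (is_series_mult _ _ _ _ U2 V2 A2 B2))].
    intros n. rewrite /minus /plus /opp /=.
    rewrite -[RHS]/(sum_f_R0 _ n). rewrite -Rminus_def -minus_sum. apply sum_eq. intros; reflexivity.
  - eapply is_series_ext; [| apply (is_series_plus (V := R_NormedModule) _ _ _ _
      (is_series_mult _ _ _ _ U1 V2 A1 B2) (is_series_mult _ _ _ _ U2 V1 A2 B1))].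
    intros n. rewrite /plus /=. rewrite -sum_plus. apply sum_eq. intros; reflexivity.
Qed.

Definition CPSeries (c : nat -> R) (w : C) : C := CSeries (fun n => RtoC (c n) * w ^ n)%C.

Lemma Cmod_term (c : nat -> R) (w : C) (n : nat) :
  Cmod (RtoC (c n) * w ^ n) = Rabs (c n * Cmod w ^ n).
Proof.
  rewrite Cmod_mult Cmod_R Cmod_pow Rabs_mult (Rabs_right (_ ^ _)) //.
  apply Rle_ge, pow_le, Cmod_ge_0.
Qed.

Lemma CPSeries_abs (c : nat -> R) (w : C) : CV_disk c (Cmod w) ->
  ex_series (fun n => Cmod (RtoC (c n) * w ^ n)).
Proof.
  intros H. eapply ex_series_ext; [| exact H]. intros n. symmetry. apply Cmod_term.
Qed.

Lemma CPSeries_correct (c : nat -> R) (w : C) : CV_disk c (Cmod w) ->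
  is_Cseries (fun n => RtoC (c n) * w ^ n)%C (CPSeries c w).
Proof. intros H. apply is_Cseries_abs, CPSeries_abs, H. Qed.

Lemma CPSeries_ext (c d : nat -> R) (w : C) :
  (forall n, c n = d n) -> CPSeries c w = CPSeries d w.
Proof. intros H. f_equal. apply functional_extensionality, H. Qed.

Lemma CPSeries_opp (c : nat -> R) (w : C) : CV_disk c (Cmod w) ->
  CPSeries (fun n => - c n) w = (- CPSeries c w)%C.
Proof.
  intros H. apply is_Cseries_unique.
  replace (- CPSeries c w)%C with ((-1) * CPSeries c w)%C by ring.
  eapply is_Cseries_ext; [| apply is_Cseries_scal, CPSeries_correct, H].
  intros n. cbv beta. rewrite RtoC_opp. ring.
Qed.

Lemma CV_disk_mult (c d : nat -> R) (x : R) :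
  CV_disk c x -> CV_disk d x -> CV_disk (PS_mult c d) x.
Proof.
  intros Hc Hd. unfold CV_disk.
  destruct (ex_series_dominated _ _ (fun n => Req_le _ _ (Rabs_Rabsolu (c n * x ^ n))) Hc) as [lc Hc'].
  destruct (ex_series_dominated _ _ (fun n => Req_le _ _ (Rabs_Rabsolu (d n * x ^ n))) Hd) as [ld Hd'].
  eapply ex_series_dominated; [| eexists; apply (is_series_mult _ _ _ _ Hc' Hd')].
  - intros n. cbv beta. unfold PS_mult. rewrite Rmult_comm scal_sum.
    eapply Rle_trans; [apply Rsum_abs |]. apply Req_le, sum_eq. intros i Hi.
    rewrite !Rabs_Rabsolu -Rabs_mult. f_equal.
    replace n with (i + (n - i))%nat at 2 by lia. rewrite pow_add. ring.
  - eapply ex_series_ext; [| exists lc; exact Hc']. intros n; simpl. rewrite !Rabs_Rabsolu //.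
  - eapply ex_series_ext; [| exists ld; exact Hd']. intros n; simpl. rewrite !Rabs_Rabsolu //.
Qed.

Lemma CPSeries_mult (c d : nat -> R) (w : C) : CV_disk c (Cmod w) -> CV_disk d (Cmod w) ->
  CPSeries (PS_mult c d) w = (CPSeries c w * CPSeries d w)%C.
Proof.
  intros Hc Hd. apply is_Cseries_unique.
  eapply is_Cseries_ext; [| apply (is_Cseries_mult _ _ _ _ (CPSeries_correct _ _ Hc)
    (CPSeries_correct _ _ Hd) (CPSeries_abs _ _ Hc) (CPSeries_abs _ _ Hd))].
  intros n. cbv beta.
  assert (E : forall k, (k <= n)%nat ->
    (RtoC (c k) * w ^ k * (RtoC (d (n - k)%nat) * w ^ (n - k)))%C = (RtoC (c k * d (n - k)%nat) * w ^ n)%C).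
  { intros k Hk. rewrite RtoC_mult. replace n with (k + (n - k))%nat at 4 by lia.
    rewrite Cpow_add_r. ring. }
  unfold PS_mult. rewrite (sum_eq _ (fun k => c k * d (n - k)%nat * Re (w ^ n)%C) n).
  - rewrite (sum_eq (fun k => Im _) (fun k => c k * d (n - k)%nat * Im (w ^ n)%C) n).
    + rewrite -!scal_sum. apply injective_projections; simpl; unfold Re, Im; ring.
    + intros k Hk. rewrite E // im_scal_l //.
  - intros k Hk. rewrite E // re_scal_l //.
Qed.

Lemma CPSeries_real (c : nat -> R) (x : R) : CPSeries c (RtoC x) = RtoC (PSeries c x).
Proof.
  apply injective_projections;
    [change (Series (fun n => Re (RtoC (c n) * RtoC x ^ n)%C) = PSeries c x)
    | change (Series (fun n => Im (RtoC (c n) * RtoC x ^ n)%C) = 0)].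
  - apply Series_ext. intros n. rewrite -RtoC_pow -RtoC_mult. reflexivity.
  - rewrite -(Rmult_0_l (Series (fun _ => 0))) -Series_scal_l.
    apply Series_ext. intros n. rewrite -RtoC_pow -RtoC_mult. simpl. ring.
Qed.

Lemma CPSeries_norm_le (c : nat -> R) (w : C) : (forall n, 0 <= c n) -> CV_disk c (Cmod w) ->
  Cmod (CPSeries c w) <= PSeries c (Cmod w).
Proof.
  intros Hc H.
  apply (is_Cseries_norm (fun n => RtoC (c n) * w ^ n)%C (fun n => c n * Cmod w ^ n)); [| apply CPSeries_correct, H |].
  - intros n. rewrite Cmod_term Rabs_right; [lra |].
    apply Rle_ge, Rmult_le_pos; [apply Hc | apply pow_le, Cmod_ge_0].
  - apply Series_correct, ex_series_Rabs, H.
Qed.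

Lemma CV_disk_le_radius (c : nat -> R) (y : R) : CV_disk c y -> Rbar_le y (CV_radius c).
Proof.
  intros Hy. unfold CV_radius, Lub_Rbar. case: (ex_lub_Rbar (CV_disk c)) => l /= [Hub _].
  exact (Hub y Hy).
Qed.

Lemma CV_disk_derive (c : nat -> R) (x y : R) : 0 <= x < y -> CV_disk c y ->
  CV_disk (PS_derive c) x.
Proof.
  intros Hxy Hy. apply CV_disk_inside. rewrite CV_radius_derive.
  apply Rbar_lt_le_trans with (Finite y).
  - simpl. rewrite Rabs_right; lra.
  - apply CV_disk_le_radius, Hy.
Qed.

Definition entire_coefs (c : nat -> R) : Prop := forall x, 0 <= x -> CV_disk c x.

Lemma entire_coefs_derive (c : nat -> R) : entire_coefs c -> entire_coefs (PS_derive c).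
Proof. intros H x Hx. apply (CV_disk_derive c x (x + 1)); [lra |]. apply H; lra. Qed.

Lemma entire_coefs_radius (c : nat -> R) (x : R) : entire_coefs c -> Rbar_lt (Rabs x) (CV_radius c).
Proof.
  intros H. apply Rbar_lt_le_trans with (Finite (Rabs x + 1)).
  - simpl. lra.
  - apply CV_disk_le_radius, H. pose proof (Rabs_pos x); lra.
Qed.

(** * Complex derivatives from quadratic remainder bounds *)

Lemma is_derive_C_intro (f : C -> C) (z l : C) :
  (exists K, 0 <= K /\ exists d, 0 < d /\ forall h, Cmod h < d ->
    Cmod (f (z + h) - f z - h * l)%C <= K * (Cmod h * Cmod h)) ->
  is_derive f z l.
Proof.
  intros [K [HK [d [Hd H]]]]. split; [apply is_linear_scal_l |].
  intros x Hx. apply (is_filter_lim_locally_unique (V := AbsRing_NormedModule C_AbsRing)) in Hx. subst x.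
  intros eps.
  (* K may be 0, hence the divisor K + 1. *)
  assert (He : 0 < Rmin d (eps / (K + 1))).
  { apply Rmin_pos; [exact Hd |]. apply Rdiv_lt_0_compat; [apply cond_pos | lra]. }
  exists (mkposreal _ He). intros y Hy.
  assert (Hy' : Cmod (y - z) < Rmin d (eps / (K + 1))) by exact Hy.
  change (Cmod (f y - f z - (y - z) * l)%C <= eps * Cmod (y - z)%C).
  replace y with (z + (y - z))%C at 1 by ring.
  eapply Rle_trans; [apply H; eapply Rlt_le_trans; [exact Hy' | apply Rmin_l] |].
  rewrite -Rmult_assoc. apply Rmult_le_compat_r; [apply Cmod_ge_0 |].
  assert (Cmod (y - z) < eps / (K + 1)) by (eapply Rlt_le_trans; [exact Hy' | apply Rmin_r]).
  apply Rle_trans with ((K + 1) * (eps / (K + 1))).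
  - apply Rmult_le_compat; [lra | apply Cmod_ge_0 | lra | lra].
  - apply Req_le. field. lra.
Qed.

(** The remainder satisfies D_(n+1) = (w + h) D_n + n h^2 w^(n-1), and 1 <= X lets every power be
    raised to X^(n+1). At n = 0 the value of [pred n] is harmless because of the factor [INR n]. *)
Lemma Cpow_taylor (w h : C) (X : R) (n : nat) :
  1 <= X -> Cmod w <= X -> Cmod (w + h) <= X ->
  Cmod ((w + h) ^ n - w ^ n - h * (RtoC (INR n) * w ^ (pred n)))%C
    <= INR n * INR n * X ^ n * (Cmod h * Cmod h).
Proof.
  intros HX Hw Hwh.
  pose proof (Cmod_ge_0 w) as Hw0. pose proof (Cmod_ge_0 (w + h)) as Hwh0.
  pose proof (Cmod_ge_0 h) as Hh0.
  induction n as [| n IH].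
  - simpl. replace (1 - 1 - h * (0 * 1))%C with (RtoC 0) by ring. rewrite Cmod_0. lra.
  - assert (Hn := pos_INR n).
    set (D := ((w + h) ^ n - w ^ n - h * (RtoC (INR n) * w ^ (pred n)))%C) in *.
    replace ((w + h) ^ S n - w ^ S n - h * (RtoC (INR (S n)) * w ^ (pred (S n))))%C
      with ((w + h) * D + RtoC (INR n) * (h * h * w ^ (pred n)))%C.
    + eapply Rle_trans; [apply Cmod_triangle |].
      rewrite !Cmod_mult Cmod_R Cmod_pow (Rabs_right (INR n)); [| lra].
      assert (E1 : Cmod w ^ pred n <= X ^ S n).
      { apply Rle_trans with (X ^ pred n); [apply pow_incr; lra |].
        apply Rle_pow; [exact HX | lia]. }
      assert (E2 : Cmod (w + h) * Cmod D <= X * (INR n * INR n * X ^ n * (Cmod h * Cmod h))).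
      { apply Rmult_le_compat; auto. apply Cmod_ge_0. }
      assert (E3 : INR n * (Cmod h * Cmod h * Cmod w ^ pred n) <= INR n * (Cmod h * Cmod h * X ^ S n)).
      { repeat apply Rmult_le_compat_l; try nra. }
      rewrite S_INR. simpl in *.
      assert (0 < X ^ n) by (apply pow_lt; lra).
      assert (0 <= (INR n + 1) * (X * X ^ n * (Cmod h * Cmod h))).
      { repeat apply Rmult_le_pos; lra. }
      nra.
    + unfold D. rewrite S_INR RtoC_plus. destruct n as [| n].
      * simpl. ring.
      * simpl pred. rewrite !Cpow_S. ring.
Qed.

Lemma is_derive_CPSeries (c : nat -> R) (w : C) : entire_coefs c ->
  is_derive (CPSeries c) w (CPSeries (PS_derive c) w).
Proof.
  intros Hc. apply is_derive_C_intro.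
  set (X := Cmod w + 1).
  pose proof (Cmod_ge_0 w) as Hw0.
  (* The factor n^2 is absorbed by convergence at 4 X, since n <= 2^n; the choice X = |w| + 1 covers
     all |h| < 1. *)
  assert (HS : ex_series (fun n => Rabs (c n) * (INR n * INR n * X ^ n))).
  { eapply (ex_series_le (K := R_AbsRing) (V := R_CompleteNormedModule));
      [| apply (Hc (4 * X)); unfold X; lra].
    intros n. rewrite /norm /= /abs /=.
    assert (HXn : 0 < X ^ n) by (apply pow_lt; unfold X; lra).
    rewrite !Rabs_mult Rabs_Rabsolu. apply Rmult_le_compat_l; [apply Rabs_pos |].
    rewrite Rpow_mult_distr. rewrite !Rabs_right; try (apply Rle_ge; try apply pos_INR; nra).
    - apply Rmult_le_compat_r; [lra |].
      assert (H2 : INR n <= 2 ^ n).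
      { clear. induction n as [| n IH]; [simpl; lra |]. rewrite S_INR. simpl.
        pose proof (pow_R1_Rle 2 n ltac:(lra)). lra. }
      replace 4 with (2 * 2) by ring. rewrite Rpow_mult_distr.
      apply Rmult_le_compat; auto; apply pos_INR.
    - apply Rle_ge, Rmult_le_pos; [apply pow_le; lra | lra]. }
  destruct HS as [K HK].
  exists K. split.
  { apply (is_series_nonneg _ _) with (2 := HK). intros n.
    repeat apply Rmult_le_pos; try apply pos_INR; [apply Rabs_pos | apply pow_le; unfold X; lra]. }
  exists 1. split; [lra |]. intros h Hh.
  assert (Hwh : Cmod (w + h) <= X).
  { unfold X. pose proof (Cmod_triangle w h). lra. }
  apply (is_Cseries_norm
    (fun n => RtoC (c n) * ((w + h) ^ n - w ^ n - h * (RtoC (INR n) * w ^ (pred n))))%C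
    (fun n => Rabs (c n) * (INR n * INR n * X ^ n) * (Cmod h * Cmod h))).
  - intros n. rewrite Cmod_mult Cmod_R Rmult_assoc.
    apply Rmult_le_compat_l; [apply Rabs_pos |].
    apply Cpow_taylor; unfold X in *; lra.
  - assert (H1 := CPSeries_correct c (w + h) (Hc _ (Cmod_ge_0 _))).
    assert (H2 := is_Cseries_scal (-1) _ _ (CPSeries_correct c w (Hc _ (Cmod_ge_0 _)))).
    (* The derived series is padded with a zero term at n = 0, so that it aligns index by index with
       the other two. *)
    assert (H3 : is_Cseries (fun n => - h * (RtoC (INR n * c n) * w ^ (pred n)))%C
                   (- h * CPSeries (PS_derive c) w)%C).
    { apply is_Cseries_scal, is_Cseries_decr_1.
      - simpl. rewrite Rmult_0_l. ring.
      - apply CPSeries_correct, entire_coefs_derive; [exact Hc | apply Cmod_ge_0]. }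
    replace (CPSeries c (w + h) - CPSeries c w - h * CPSeries (PS_derive c) w)%C
      with (CPSeries c (w + h) + (-1) * CPSeries c w + - h * CPSeries (PS_derive c) w)%C by ring.
    eapply is_Cseries_ext; [| apply (is_Cseries_plus _ _ _ _ (is_Cseries_plus _ _ _ _ H1 H2) H3)].
    intros n. cbv beta. rewrite RtoC_mult. ring.
  - apply (is_series_scal_r (Cmod h * Cmod h)), HK.
Qed.

Lemma is_derive_Cinv (z : C) : z <> RtoC 0 -> is_derive Cinv z (- (/ z * / z))%C.
Proof.
  intros Hz. assert (Hm : 0 < Cmod z) by (apply Cmod_gt_0, Hz).
  apply is_derive_C_intro.
  (* The remainder is exactly h^2 / (z^2 (z + h)), and |z + h| >= |z| / 2 for |h| < |z| / 2. *)
  exists (2 / (Cmod z * Cmod z * Cmod z)). split.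
  { left. apply Rdiv_lt_0_compat; [lra |]. repeat apply Rmult_lt_0_compat; exact Hm. }
  exists (Cmod z / 2). split; [lra |]. intros h Hh.
  assert (Hzh : Cmod z / 2 <= Cmod (z + h)).
  { pose proof (Cmod_triangle (z + h) (- h)) as H. rewrite Cmod_opp in H.
    replace (z + h + - h)%C with z in H by ring. lra. }
  assert (Hnz : (z + h)%C <> RtoC 0) by (apply Cmod_gt_0; lra).
  replace (/ (z + h) - / z - h * - (/ z * / z))%C with (h * h * / (z * z * (z + h)))%C by (field; auto).
  assert (Hne : (z * z * (z + h))%C <> RtoC 0) by (repeat apply Cmult_neq_0; auto).
  rewrite !Cmod_mult Cmod_inv // !Cmod_mult Rmult_comm.
  apply Rmult_le_compat_r; [pose proof (Cmod_ge_0 h); nra |].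
  replace (2 / (Cmod z * Cmod z * Cmod z)) with (/ (Cmod z * Cmod z * (Cmod z / 2))) by (field; lra).
  apply Rinv_le_contravar; [repeat apply Rmult_lt_0_compat; lra |].
  apply Rmult_le_compat_l; [nra | exact Hzh].
Qed.

(** * The series of the Bessel function and its Riccati equation *)

(** The zero is the supremum of the points up to which f stays positive, so minimality is built in.
    All three zeros of the theorem are obtained in this way. *)
Lemma first_zero (f : R -> R) (B : R) :
  (forall x, continuous f x) -> 0 < B -> 0 < f 0 -> f B <= 0 ->
  exists z, 0 < z <= B /\ f z = 0 /\ forall x, 0 <= x < z -> 0 < f x.
Proof.
  intros Hc HB H0 HfB.
  set (E := fun x => 0 <= x <= B /\ forall y, 0 <= y <= x -> 0 < f y).
  assert (HE0 : E 0) by (split; [lra | intros y Hy; replace y with 0 by lra; exact H0]).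
  destruct (completeness E) as [z [Hub Hl]].
  { exists B. intros x Hx. apply Hx. }
  { exists 0. exact HE0. }
  assert (Hz0 : 0 <= z) by (apply Hub; exact HE0).
  assert (HzB : z <= B) by (apply Hl; intros x Hx; apply Hx).
  assert (Hpos : forall x, 0 <= x < z -> 0 < f x).
  { intros x Hx. apply NNPP. intros Hn.
    assert (z <= x); [| lra]. apply Hl. intros y [Hy1 Hy2].
    apply Rnot_lt_le. intros Hxy. apply Hn, Hy2. lra. }
  assert (Hloc : forall e, 0 < e -> exists d, 0 < d /\ forall y, Rabs (y - z) < d -> Rabs (f y - f z) < e).
  { intros e He. destruct (proj1 (filterlim_locally _ _) (Hc z) (mkposreal e He)) as [d Hd].
    exists d. split; [apply cond_pos | exact Hd]. }
  assert (Hfz : f z = 0).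
  { destruct (Rtotal_order (f z) 0) as [Hlt | [Heq | Hgt]]; [| exact Heq |]; exfalso.
    - destruct (Hloc (- f z) ltac:(lra)) as [d [Hd Hy]].
      destruct (Req_dec z 0) as [-> | Hne]; [lra |].
      set (y := Rmax 0 (z - d / 2)).
      assert (0 <= y) by apply Rmax_l. assert (z - d / 2 <= y) by apply Rmax_r.
      assert (y < z) by (apply Rmax_lub_lt; lra).
      specialize (Hy y ltac:(apply Rabs_def1; lra)). apply Rabs_def2 in Hy.
      specialize (Hpos y ltac:(lra)). lra.
    - destruct (Hloc (f z) Hgt) as [d [Hd Hy]].
      destruct (Req_dec z B) as [-> | Hne]; [lra |].
      set (y := Rmin B (z + d / 2)).
      assert (y <= B) by apply Rmin_l. assert (y <= z + d / 2) by apply Rmin_r.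
      assert (z < y) by (apply Rmin_glb_lt; lra).
      assert (y <= z); [| lra]. apply Hub. split; [lra |].
      intros x Hx. destruct (Rlt_le_dec x z); [apply Hpos; lra |].
      specialize (Hy x ltac:(apply Rabs_def1; lra)). apply Rabs_def2 in Hy. lra. }
  exists z. split; [| split; auto]. split; [| exact HzB].
  destruct Hz0 as [Hz0 | Hz0]; [exact Hz0 |]. rewrite -Hz0 in Hfz. lra.
Qed.

Lemma nonincreasing_is_derive (f df : R -> R) (a b : R) :
  a <= b -> (forall x, a <= x <= b -> is_derive f x (df x)) ->
  (forall x, a <= x <= b -> df x <= 0) -> f b <= f a.
Proof.
  intros Hab Hd Hneg.
  destruct (MVT_gen f a b df) as [c [Hc E]].
  - intros x Hx. rewrite Rmin_left ?Rmax_right in Hx; try lra. apply Hd. lra.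
  - intros x Hx. rewrite Rmin_left ?Rmax_right in Hx; try lra.
    apply continuity_pt_filterlim. apply (ex_derive_continuous f). eexists. apply Hd. lra.
  - rewrite Rmin_left ?Rmax_right in Hc; try lra.
    specialize (Hneg c Hc). nra.
Qed.

Definition psum (c : nat -> R) (n : nat) (x : R) : R := sum_f_R0 (fun k => c k * x ^ k) n.

Lemma is_derive_psum (c : nat -> R) (n : nat) (x : R) :
  is_derive (psum c n) x (sum_f_R0 (fun k => INR k * c k * x ^ pred k) n).
Proof.
  induction n as [| n IH].
  - unfold psum. simpl. rewrite !Rmult_0_l. apply (is_derive_const (V := R_NormedModule)).
  - apply (is_derive_ext (fun y => plus (psum c n y) (c (S n) * y ^ S n))).
    + intros y. unfold psum. rewrite tech5. reflexivity.
    + rewrite tech5. apply (is_derive_plus (V := R_NormedModule)); [exact IH |].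
      auto_derive; [trivial |]. simpl. ring.
Qed.

Lemma psum_nonneg (c : nat -> R) (n : nat) (x : R) :
  (forall k, 0 <= c k) -> 0 <= x -> 0 <= psum c n x.
Proof. intros Hc Hx. apply cond_pos_sum. intros k. apply Rmult_le_pos; auto. apply pow_le, Hx. Qed.

Lemma psum_PS_mult_le (c d : nat -> R) (n : nat) (x : R) :
  (forall k, 0 <= c k) -> (forall k, 0 <= d k) -> 0 <= x ->
  psum (PS_mult c d) n x <= psum c n x * psum d n x.
Proof.
  intros Hc Hd Hx. unfold psum.
  rewrite (sum_eq _ (PS_mult (fun k => c k * x ^ k) (fun k => d k * x ^ k)) n).
  - apply sum_PS_mult_le; intros k; apply Rmult_le_pos; auto; apply pow_le, Hx.
  - intros; apply PS_mult_weight.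
Qed.

Lemma psum_le_S (c : nat -> R) (n : nat) (x : R) :
  (forall k, 0 <= c k) -> 0 <= x -> psum c n x <= psum c (S n) x.
Proof.
  intros Hc Hx. unfold psum. rewrite tech5.
  assert (0 <= c (S n) * x ^ S n) by (apply Rmult_le_pos; auto; apply pow_le, Hx). lra.
Qed.

Lemma is_series_head (x : R) : is_series (fun n => match n with O => x | _ => 0 end) x.
Proof.
  apply (filterlim_ext (fun _ => x)); [| apply filterlim_const].
  induction x0 as [| n IH]; [rewrite sum_O // |].
  rewrite sum_Sn -IH /plus /=. ring.
Qed.

(** * Comparison of the truncated series with F on the real axis *)

Section Comparison.

Variables (mu : R) (a t b : nat -> R).
Hypothesis Hmu : 0 < mu.
Hypothesis Ha0 : a O = 1.
Hypothesis Harec : forall n, INR (S n) * (INR n + mu) * a (S n) = - a n / 4.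
Hypothesis Ht : riccati mu t.
Hypothesis Hb : inverse_series t b.

Lemma entire_bessel_series : entire_coefs a.
Proof.
  assert (Hne : forall n, a n <> 0).
  { induction n as [| n IH]; [rewrite Ha0; lra |].
    intros E. pose proof (Harec n) as H1. rewrite E in H1. apply IH. lra. }
  assert (HR : CV_radius a = p_infty).
  { apply CV_radius_infinite_DAlembert; [exact Hne |].
    apply (is_lim_seq_le_le (fun _ => 0) _ (fun n => / (4 * mu) * / INR (S n)) (Finite 0)).
    - intros n. split; [apply Rabs_pos |].
      pose proof (pos_INR n). pose proof (Harec n) as H1.
      assert (HS : 0 < INR (S n)) by (apply lt_0_INR; lia).
      assert (E : a (S n) / a n = - / (4 * INR (S n) * (INR n + mu))).
      { apply (Rmult_eq_reg_l (4 * INR (S n) * (INR n + mu))); [| nra].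
        replace (4 * INR (S n) * (INR n + mu) * (a (S n) / a n))
          with (4 * (INR (S n) * (INR n + mu) * a (S n)) / a n) by (field; apply Hne).
        rewrite H1. field. repeat split; try lra. apply Hne. }
      rewrite E Rabs_Ropp Rabs_right.
      + rewrite -Rinv_mult. apply Rinv_le_contravar; nra.
      + apply Rle_ge. left. apply Rinv_0_lt_compat. repeat apply Rmult_lt_0_compat; lra.
    - apply is_lim_seq_const.
    - replace (Finite 0) with (Rbar_mult (/ (4 * mu)) 0) by (simpl; f_equal; ring).
      apply is_lim_seq_scal_l.
      replace (Finite 0) with (Rbar_inv p_infty) by reflexivity.
      apply is_lim_seq_inv; [| discriminate].
      apply -> (is_lim_seq_incr_1 INR). apply is_lim_seq_INR. }
  intros x Hx. apply CV_disk_inside. rewrite HR. exact I.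
Qed.

Let F0 := PSeries a.
Let F1 := PSeries (PS_derive a).
Let F2 := PSeries (PS_derive (PS_derive a)).

Lemma is_derive_F0 (x : R) : is_derive F0 x (F1 x).
Proof. apply is_derive_PSeries, entire_coefs_radius, entire_bessel_series. Qed.

Lemma is_derive_F1 (x : R) : is_derive F1 x (F2 x).
Proof. apply is_derive_PSeries, entire_coefs_radius, entire_coefs_derive, entire_bessel_series. Qed.

Lemma F0_0 : F0 0 = 1.
Proof. unfold F0. rewrite PSeries_0. exact Ha0. Qed.

(** Bessel's equation after removal of the factor z^nu and the substitution w = z^2; coefficientwise
    it is the recursion [Harec]. *)
Lemma bessel_ode (x : R) : x * F2 x + mu * F1 x + F0 x / 4 = 0.
Proof.
  assert (Hex : forall c, entire_coefs c -> ex_pseries c x).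
  { intros c Hc. apply CV_radius_inside, entire_coefs_radius, Hc. }
  assert (E0 := Hex _ entire_bessel_series).
  assert (E1 := Hex _ (entire_coefs_derive _ entire_bessel_series)).
  assert (E2 := Hex _ (entire_coefs_derive _ (entire_coefs_derive _ entire_bessel_series))).
  replace (F0 x / 4) with (/ 4 * F0 x) by field.
  unfold F0, F1, F2. rewrite -PSeries_incr_1 -!PSeries_scal.
  rewrite -!PSeries_plus.
  - transitivity (PSeries (fun _ => 0) x); [| apply PSeries_const_0].
    apply PSeries_ext. intros n. unfold PS_plus, PS_scal, PS_incr_1, PS_derive.
    rewrite /plus /scal /mult /zero. pose proof (Harec n) as H1. destruct n as [| n]; cbn -[INR].
    + simpl (INR 0) in H1. lra.
    + transitivity (INR (S (S n)) * (INR (S n) + mu) * a (S (S n)) + a (S n) * / 4);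
        [ring | rewrite H1; field].
  - apply ex_pseries_plus; [apply ex_pseries_incr_1, E2 |].
    apply ex_pseries_scal; [apply Rmult_comm | exact E1].
  - apply ex_pseries_scal; [apply Rmult_comm | exact E0].
  - apply ex_pseries_incr_1, E2.
  - apply ex_pseries_scal; [apply Rmult_comm | exact E1].
Qed.

Lemma PSeries_derive_0 : F1 0 = - t O.
Proof.
  unfold F1. rewrite PSeries_0 (log_derivative mu a Hmu Ha0 Harec t Ht O).
  unfold PS_mult. simpl. rewrite Ha0. ring.
Qed.

(** The coefficients of the truncation satisfy the equation up to degree n; squaring the truncation
    contributes in addition only nonnegative terms. *)
Lemma psum_riccati (n : nat) (x : R) : 0 <= x ->
  x * sum_f_R0 (fun k => INR k * t k * x ^ pred k) n + mu * psum t n x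
    <= / 4 + x * (psum t n x * psum t n x).
Proof.
  intros Hx. pose proof (riccati_nonneg mu Hmu t Ht) as Htn.
  assert (E : x * sum_f_R0 (fun k => INR k * t k * x ^ pred k) n + mu * psum t n x
    = sum_f_R0 (fun k => (INR k + mu) * t k * x ^ k) n).
  { unfold psum. rewrite !scal_sum -sum_plus. apply sum_eq. intros [| i] _; simpl; ring. }
  rewrite E. destruct n as [| n].
  - simpl. pose proof (Ht O) as H0. simpl in H0. rewrite H0. unfold psum. simpl.
    pose proof (Htn O). assert (0 <= x * (t O * 1 * (t O * 1))) by (repeat apply Rmult_le_pos; lra). lra.
  - rewrite decomp_sum; [| lia]. simpl pred.
    replace ((INR 0 + mu) * t O * x ^ 0) with (/ 4);
      [| pose proof (Ht O) as H0; simpl in *; lra].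
    apply Rplus_le_compat_l.
    rewrite (sum_eq _ (fun k => PS_mult t t k * x ^ k * x) n).
    + rewrite -scal_sum. apply Rmult_le_compat_l; [exact Hx |].
      eapply Rle_trans; [apply (psum_PS_mult_le t t n x); auto |].
      pose proof (psum_le_S t n x Htn Hx). pose proof (psum_nonneg t n x Htn Hx).
      apply Rmult_le_compat; auto.
    + intros i _. pose proof (Ht (S i)) as H1. cbv beta iota in H1. rewrite -H1. simpl. ring.
Qed.

(** [B] is any bound below which F is positive, not the first zero itself: the existence of a zero
    is deduced from this section by letting [B] be too large. *)
Variable B : R.
Hypothesis HB : forall x, 0 <= x < B -> 0 < F0 x.

(* Sturm-type comparison: a truncation of the nonnegative solution t of the Riccati equation is a
   subsolution, so x^mu exp(-int t_n) (F0' + t_n F0) is nonincreasing, and it vanishes at 0. *)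
Lemma psum_le_log_derivative (n : nat) (x : R) : 0 <= x < B -> psum t n x * F0 x <= - F1 x.
Proof.
  intros Hx. pose proof (riccati_nonneg mu Hmu t Ht) as Htn.
  destruct (Req_dec x 0) as [-> | Hx0].
  { rewrite F0_0 PSeries_derive_0. apply Req_le. unfold psum.
    destruct n as [| n]; [simpl; ring |]. rewrite decomp_sum; [| lia].
    rewrite (sum_eq_R0 (fun i => _)); [simpl; ring | intros; simpl; ring]. }
  apply Rnot_lt_le. intros Hlt.
  set (T := psum t n). set (T' := fun x => sum_f_R0 (fun k => INR k * t k * x ^ pred k) n).
  set (P := fun x => F1 x + T x * F0 x).
  set (q := fun k => match k with O => 0 | S k => t k / INR (S k) end).
  set (Q := psum q (S n)).
  assert (HQ : forall y, is_derive Q y (T y)).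
  { intros y. replace (T y) with (sum_f_R0 (fun k => INR k * q k * y ^ pred k) (S n));
      [apply is_derive_psum |].
    rewrite decomp_sum; [| lia]. simpl pred. simpl (INR 0). rewrite !Rmult_0_l Rplus_0_l.
    apply sum_eq. intros i _. unfold q. cbv iota. field. apply not_0_INR; lia. }
  assert (HP : forall y, is_derive P y (F2 y + (T' y * F0 y + T y * F1 y))).
  { intros y. apply (is_derive_plus (V := R_NormedModule)); [apply is_derive_F1 |].
    apply (is_derive_mult (K := R_AbsRing) T F0);
      [apply is_derive_psum | apply is_derive_F0 | apply Rmult_comm]. }
  set (V := fun y => exp (mu * ln y - Q y) * P y).
  assert (HV : forall y, 0 < y -> is_derive V y
    (exp (mu * ln y - Q y) * ((mu / y - T y) * P y + (F2 y + (T' y * F0 y + T y * F1 y))))).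
  { intros y Hy.
    replace (exp (mu * ln y - Q y) * ((mu / y - T y) * P y + (F2 y + (T' y * F0 y + T y * F1 y))))
      with ((mu / y - T y) * exp (mu * ln y - Q y) * P y
            + exp (mu * ln y - Q y) * (F2 y + (T' y * F0 y + T y * F1 y))) by ring.
    apply (is_derive_mult (K := R_AbsRing) (fun y => exp (mu * ln y - Q y)) P);
      [| apply HP | apply Rmult_comm].
    apply (is_derive_comp exp (fun y => mu * ln y - Q y)).
    - apply is_derive_Reals, derivable_pt_lim_exp.
    - apply (is_derive_minus (V := R_NormedModule) (fun y => mu * ln y)); [| apply HQ].
      auto_derive; [exact Hy | field; lra]. }
  assert (HV0 : forall y, 0 < y <= x -> V x <= V y).
  { intros y Hy. eapply nonincreasing_is_derive; [apply Hy | intros z Hz; apply HV; lra |].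
    intros z Hz. cbv beta.
    assert (0 < exp (mu * ln z - Q z)) by apply exp_pos.
    assert (Hle : (mu / z - T z) * P z + (F2 z + (T' z * F0 z + T z * F1 z)) <= 0); [| nra].
    apply (Rmult_le_reg_l z); [lra |]. rewrite Rmult_0_r.
    (* After multiplication by z the derivative splits into the left side of Bessel's equation,
       which vanishes, and F times the Riccati defect of the truncation, which is nonpositive. *)
    replace (z * ((mu / z - T z) * P z + (F2 z + (T' z * F0 z + T z * F1 z))))
      with ((z * F2 z + mu * F1 z + F0 z / 4)
        + F0 z * (z * T' z + mu * T z - (/ 4 + z * (T z * T z)))) by (unfold P; field; lra).
    rewrite bessel_ode Rplus_0_l.
    pose proof (psum_riccati n z ltac:(lra)) as Hr. fold T in Hr. fold (T' z) in Hr.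
    pose proof (HB z ltac:(lra)). nra. }
  assert (HVx : 0 < V x).
  { apply Rmult_lt_0_compat; [apply exp_pos |]. unfold P, T. lra. }
  destruct (continuity_ab_maj P 0 x) as [m [Hm _]]; [lra | |].
  { intros y _. apply continuity_pt_filterlim. apply (ex_derive_continuous P). eexists. apply HP. }
  (* V x is positive by the negated claim, yet V x <= V y <= y^mu M for small y. The maximum with 1
     keeps M positive, so that y can be chosen with y^mu < V x / M. *)
  set (M := Rmax 1 (P m)).
  assert (HM1 : 1 <= M) by apply Rmax_l.
  assert (HM : forall y, 0 <= y <= x -> P y <= M).
  { intros y Hy. eapply Rle_trans; [apply Hm, Hy | apply Rmax_r]. }
  assert (He : 0 < V x / M) by (apply Rdiv_lt_0_compat; lra).
  destruct (proj1 (filterlim_locally _ _) (Rpower_lim_0 mu Hmu) (mkposreal _ He)) as [d Hd].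
  set (y := Rmin x (d / 2)).
  assert (Hd0 := cond_pos d).
  assert (Hy0 : 0 < y) by (apply Rmin_pos; lra).
  assert (Hyx : y <= x) by apply Rmin_l.
  assert (Hyd : y <= d / 2) by apply Rmin_r.
  specialize (Hd y).
  assert (Hpow : Rpower y mu < V x / M).
  { assert (H1 : Rabs (Rpower y mu - 0) < V x / M).
    { apply Hd; [| exact Hy0]. change (Rabs (y - 0) < d). rewrite Rminus_0_r Rabs_right; lra. }
    rewrite Rminus_0_r Rabs_right in H1; [exact H1 | left; apply exp_pos]. }
  specialize (HV0 y ltac:(lra)).
  assert (HVy : V y <= Rpower y mu * M).
  { unfold V. apply Rle_trans with (exp (mu * ln y - Q y) * M).
    - apply Rmult_le_compat_l; [left; apply exp_pos | apply HM; lra].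
    - apply Rmult_le_compat_r; [lra |]. unfold Rpower.
      assert (0 <= Q y).
      { apply psum_nonneg; [| lra]. intros [| k]; unfold q; [lra |].
        apply Rdiv_le_0_compat; [apply Htn | apply lt_0_INR; lia]. }
      destruct (Req_dec (Q y) 0) as [-> | Hne]; [rewrite Rminus_0_r; lra |].
      left. apply exp_increasing. lra. }
  assert (V x / M * M = V x) by (field; lra).
  assert (Rpower y mu * M < V x / M * M) by (apply Rmult_lt_compat_r; lra).
  lra.
Qed.

(** The product b_n F starts at 1 and does not increase: truncating b' = t b gives b_n' <= t_n b_n,
    and the comparison above gives F' <= - t_n F. *)
Lemma psum_inverse_le (n : nat) (x : R) : 0 <= x < B -> psum b n x * F0 x <= 1.
Proof.
  intros Hx. pose proof (riccati_nonneg mu Hmu t Ht) as Htn.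
  pose proof (inverse_series_nonneg mu Hmu t Ht b Hb) as Hbn.
  apply Rle_trans with (psum b n 0 * F0 0).
  - apply (nonincreasing_is_derive (fun y => psum b n y * F0 y)
      (fun y => sum_f_R0 (fun k => INR k * b k * y ^ pred k) n * F0 y + psum b n y * F1 y)).
    + lra.
    + intros y Hy. apply (is_derive_mult (K := R_AbsRing) (psum b n) F0);
        [apply is_derive_psum | apply is_derive_F0 | apply Rmult_comm].
    + intros y Hy.
      pose proof (psum_le_log_derivative n y ltac:(lra)) as H1.
      pose proof (HB y ltac:(lra)) as H2.
      pose proof (psum_nonneg b n y Hbn ltac:(lra)) as H3.
      assert (H4 : sum_f_R0 (fun k => INR k * b k * y ^ pred k) n <= psum t n y * psum b n y).
      { destruct n as [| n].
        - simpl. rewrite !Rmult_0_l. apply Rmult_le_pos; [apply psum_nonneg; auto; lra | exact H3].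
        - rewrite decomp_sum; [| lia]. simpl pred. simpl (INR 0). rewrite !Rmult_0_l Rplus_0_l.
          rewrite (sum_eq _ (fun k => PS_mult t b k * y ^ k) n).
          + eapply Rle_trans; [apply (psum_PS_mult_le t b n y); auto; lra |].
            apply Rmult_le_compat; try (apply psum_nonneg; auto; lra); apply psum_le_S; auto; lra.
          + intros i _. destruct Hb as [_ Hb']. rewrite -Hb'. reflexivity. }
      nra.
  - rewrite F0_0. apply Req_le. unfold psum. destruct Hb as [Hb0 _].
    destruct n as [| n]; [simpl; rewrite Hb0; ring |]. rewrite decomp_sum; [| lia].
    rewrite (sum_eq_R0 (fun i => _)); [simpl; rewrite Hb0; ring | intros; simpl; ring].
Qed.

Lemma CV_disk_psum (c : nat -> R) (x M : R) : (forall k, 0 <= c k) -> 0 <= x ->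
  (forall n, psum c n x <= M) -> CV_disk c x.
Proof.
  intros Hc Hx HM. apply (bounded_sum_ex_series _ M).
  - intros; apply Rabs_pos.
  - intros n. rewrite (sum_eq _ (fun k => c k * x ^ k) n); [apply HM |].
    intros i _. apply Rabs_right, Rle_ge, Rmult_le_pos; [apply Hc | apply pow_le, Hx].
Qed.

Lemma CV_disk_riccati (x : R) : 0 <= x < B -> CV_disk t x.
Proof.
  intros Hx. apply (CV_disk_psum t x (- F1 x / F0 x)); [apply (riccati_nonneg mu Hmu t Ht) | lra |].
  intros n. apply (Rmult_le_reg_r (F0 x)); [apply HB, Hx |].
  replace (- F1 x / F0 x * F0 x) with (- F1 x) by (field; pose proof (HB x Hx); lra).
  apply psum_le_log_derivative, Hx.
Qed.

Lemma CV_disk_inverse_series (x : R) : 0 <= x < B -> CV_disk b x.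
Proof.
  intros Hx. apply (CV_disk_psum b x (/ F0 x)); [apply (inverse_series_nonneg mu Hmu t Ht b Hb) | lra |].
  intros n. apply (Rmult_le_reg_r (F0 x)); [apply HB, Hx |].
  rewrite Rinv_l; [apply psum_inverse_le, Hx | pose proof (HB x Hx); lra].
Qed.

(* t_k >= c r^k with r = 1 / (4 mu (1 + mu)), so the truncations of t are unbounded at 1 / r. *)
Lemma first_zero_bound : B <= 4 * mu * (1 + mu).
Proof.
  apply Rnot_lt_le. intros HlB.
  set (X := 4 * mu * (1 + mu)) in *.
  assert (HX : 0 < X) by (unfold X; nra).
  assert (Hlow : forall n, / (4 * mu) * (INR n + 1) <= psum t n X).
  { intros n. replace (/ (4 * mu) * (INR n + 1)) with (sum_f_R0 (fun _ => / (4 * mu)) n)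
      by (rewrite sum_cte S_INR; ring).
    apply sum_Rle. intros k _.
    pose proof (riccati_lower mu Hmu t Ht k) as H1. fold X in H1.
    assert (HXk : 0 < X ^ k) by (apply pow_lt, HX).
    apply (Rmult_le_compat_r (X ^ k)) in H1; [| lra].
    rewrite Rmult_assoc -Rpow_mult_distr Rinv_l in H1; [| lra].
    rewrite pow1 Rmult_1_r in H1. exact H1. }
  pose proof (HB X ltac:(lra)) as HF.
  set (Y := - F1 X / F0 X * (4 * mu)).
  destruct (INR_archimed 1 Y Rlt_0_1) as [n Hn].
  pose proof (psum_le_log_derivative n X ltac:(lra)) as H1.
  specialize (Hlow n).
  assert (/ (4 * mu) * (INR n + 1) * F0 X <= - F1 X) by nra.
  assert (Y * F0 X = - F1 X * (4 * mu)) by (unfold Y; field; lra).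
  assert ((INR n + 1) * F0 X <= - F1 X * (4 * mu)).
  { apply (Rmult_le_reg_l (/ (4 * mu))); [apply Rinv_0_lt_compat; lra |].
    replace (/ (4 * mu) * (- F1 X * (4 * mu))) with (- F1 X) by (field; lra). lra. }
  nra.
Qed.

(** * Transfer to the complex disk and the bound for the convexity quotient *)

Let cF0 := CPSeries a.
Let cF1 := CPSeries (PS_derive a).
Let cF2 := CPSeries (PS_derive (PS_derive a)).
Let cT := CPSeries t.
Let cT' := CPSeries (PS_derive t).

Lemma CPSeries_log_derivative (w : C) : Cmod w < B -> cF1 w = (- (cT w * cF0 w))%C.
Proof.
  intros Hw. pose proof (Cmod_ge_0 w) as H0.
  assert (HT := CV_disk_riccati (Cmod w) (conj H0 Hw)). assert (HA := entire_bessel_series (Cmod w) H0).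
  unfold cF1. rewrite (CPSeries_ext _ (fun n => - PS_mult t a n));
    [| apply (log_derivative mu a Hmu Ha0 Harec t Ht)].
  rewrite CPSeries_opp; [| apply CV_disk_mult; assumption].
  rewrite CPSeries_mult //.
Qed.

Lemma CV_disk_derive_riccati (x : R) : 0 <= x < B -> CV_disk (PS_derive t) x.
Proof.
  intros Hx. apply (CV_disk_derive t x ((x + B) / 2)); [lra |]. apply CV_disk_riccati. lra.
Qed.

Lemma CV_disk_plus (c d : nat -> R) (x : R) : CV_disk c x -> CV_disk d x ->
  CV_disk (fun n => c n + d n) x.
Proof.
  intros Hc Hd.
  apply (ex_series_dominated _ (fun n => Rabs (c n * x ^ n) + Rabs (d n * x ^ n))).
  - intros n. rewrite Rmult_plus_distr_r. apply Rabs_triang.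
  - apply (ex_series_plus (V := R_NormedModule)); assumption.
Qed.

Lemma CPSeries_plus (c d : nat -> R) (w : C) : CV_disk c (Cmod w) -> CV_disk d (Cmod w) ->
  CPSeries (fun n => c n + d n) w = (CPSeries c w + CPSeries d w)%C.
Proof.
  intros Hc Hd. apply is_Cseries_unique.
  eapply is_Cseries_ext;
    [| apply (is_Cseries_plus _ _ _ _ (CPSeries_correct _ _ Hc) (CPSeries_correct _ _ Hd))].
  intros n. cbv beta. rewrite RtoC_plus. ring.
Qed.

Lemma CPSeries_log_derivative_2 (w : C) : Cmod w < B -> cF2 w = (- (cT' w * cF0 w + cT w * cF1 w))%C.
Proof.
  intros Hw. pose proof (Cmod_ge_0 w) as H0.
  assert (HT := CV_disk_riccati (Cmod w) (conj H0 Hw)). assert (HA := entire_bessel_series (Cmod w) H0).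
  assert (HT' := CV_disk_derive_riccati (Cmod w) (conj H0 Hw)).
  assert (HA' := entire_coefs_derive a entire_bessel_series (Cmod w) H0).
  unfold cF2. rewrite (CPSeries_ext _ (fun n => - (PS_mult (PS_derive t) a n + PS_mult t (PS_derive a) n)));
    [| apply (log_derivative_2 mu a Hmu Ha0 Harec t Ht)].
  rewrite CPSeries_opp; [| apply CV_disk_plus; apply CV_disk_mult; assumption].
  rewrite CPSeries_plus; [| apply CV_disk_mult; assumption | apply CV_disk_mult; assumption].
  rewrite !CPSeries_mult //.
Qed.

Lemma CPSeries_neq_0 (w : C) : Cmod w < B -> cF0 w <> RtoC 0.
Proof.
  intros Hw E. pose proof (Cmod_ge_0 w) as H0.
  assert (HA := entire_bessel_series (Cmod w) H0). assert (HD := CV_disk_inverse_series (Cmod w) (conj H0 Hw)).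
  pose proof (CPSeries_mult a b w HA HD) as H. fold cF0 in H. rewrite E in H.
  apply C1_nz. transitivity (CPSeries (PS_mult a b) w); [| rewrite H; ring].
  symmetry. apply is_Cseries_unique.
  eapply is_Cseries_ext with (u := fun n => match n with O => RtoC 1 | _ => RtoC 0 end).
  { intros n. rewrite (inverse_series_spec mu a Hmu Ha0 Harec t Ht b Hb).
    destruct n; simpl; ring. }
  split; eapply is_series_ext; try apply is_series_head; intros [| n]; reflexivity.
Qed.

(** The derivative of z F(z^2) is even, hence a function of w = z^2. The name comes from the Dini
    function, which is this times the prefactor of J_nu. *)
Definition dini_series (c : nat -> R) (w : C) : C :=
  (CPSeries c w + 2 * w * CPSeries (PS_derive c) w)%C.

Definition dini_slope (c : nat -> R) (w : C) : C :=
  (6 * w * CPSeries (PS_derive c) w + 4 * (w * w) * CPSeries (PS_derive (PS_derive c)) w)%C.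

Definition dini_series_R (c : nat -> R) (x : R) : R :=
  PSeries c x + 2 * x * PSeries (PS_derive c) x.

Definition dini_slope_R (c : nat -> R) (x : R) : R :=
  6 * x * PSeries (PS_derive c) x + 4 * (x * x) * PSeries (PS_derive (PS_derive c)) x.

Lemma dini_series_real (c : nat -> R) (x : R) : dini_series c (RtoC x) = RtoC (dini_series_R c x).
Proof. unfold dini_series, dini_series_R. rewrite !CPSeries_real. apply injective_projections; simpl; ring. Qed.

Lemma dini_slope_real (c : nat -> R) (x : R) : dini_slope c (RtoC x) = RtoC (dini_slope_R c x).
Proof. unfold dini_slope, dini_slope_R. rewrite !CPSeries_real. apply injective_projections; simpl; ring. Qed.

Lemma dini_series_factor (w : C) : Cmod w < B ->
  dini_series a w = (cF0 w * (1 - 2 * w * cT w))%C.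
Proof.
  intros Hw. unfold dini_series. fold cF1. rewrite CPSeries_log_derivative //. fold cF0. ring.
Qed.

Lemma dini_slope_factor (w : C) : Cmod w < B ->
  dini_slope a w
  = (- (cF0 w * (2 * w * cT w * (1 - 2 * w * cT w) + 4 * (w * cT w + w * w * cT' w))))%C.
Proof.
  intros Hw. unfold dini_slope. fold cF1 cF2. rewrite CPSeries_log_derivative_2 // CPSeries_log_derivative //. fold cF0. ring.
Qed.

Lemma dini_quotient (w : C) : Cmod w < B -> (1 - 2 * w * cT w)%C <> RtoC 0 ->
  (dini_slope a w / dini_series a w)%C
  = (- (2 * w * cT w + 4 * (w * cT w + w * w * cT' w) / (1 - 2 * w * cT w)))%C.
Proof.
  intros Hw H1. rewrite dini_slope_factor // dini_series_factor //.
  pose proof (CPSeries_neq_0 w Hw). field. auto.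
Qed.

Lemma dini_series_R_factor (x : R) : 0 <= x < B ->
  dini_series_R a x = F0 x * (1 - 2 * x * PSeries t x).
Proof.
  intros Hx. apply RtoC_inj. rewrite -dini_series_real dini_series_factor.
  - unfold cF0, cT, F0. rewrite !CPSeries_real. apply injective_projections; simpl; ring.
  - rewrite Cmod_R Rabs_right; lra.
Qed.

Lemma dini_quotient_R (x : R) : 0 <= x < B -> 1 - 2 * x * PSeries t x <> 0 ->
  dini_slope_R a x / dini_series_R a x
  = - (2 * x * PSeries t x
       + 4 * (x * PSeries t x + x * x * PSeries (PS_derive t) x) / (1 - 2 * x * PSeries t x)).
Proof.
  intros Hx H1.
  assert (H2 : dini_series_R a x <> 0).
  { rewrite dini_series_R_factor //. apply Rmult_integral_contrapositive_currified; [| exact H1].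
    apply Rgt_not_eq, HB, Hx. }
  set (d := 1 - 2 * x * PSeries t x) in *.
  assert (Ed : (1 - 2 * RtoC x * cT (RtoC x))%C = RtoC d).
  { unfold cT, d. rewrite CPSeries_real. apply injective_projections; simpl; ring. }
  assert (Hd : RtoC d <> RtoC 0) by (intros E; apply H1, RtoC_inj, E).
  apply RtoC_inj. rewrite RtoC_div // -dini_slope_real -dini_series_real dini_quotient.
  - rewrite Ed. unfold cT, cT'. rewrite !CPSeries_real RtoC_opp RtoC_plus RtoC_div //.
    f_equal. f_equal; [| f_equal]; apply injective_projections; simpl; ring.
  - rewrite Cmod_R Rabs_right; lra.
  - rewrite Ed. exact Hd.
Qed.

(* All coefficients of t are nonnegative, so passing to absolute values in the right-hand side of
   dini_quotient gives its value at |w|. *)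
Lemma dini_quotient_bound (w : C) : Cmod w < B -> 0 < dini_series_R a (Cmod w) ->
  dini_series a w <> RtoC 0 /\
  Cmod (dini_slope a w / dini_series a w)%C
    <= - (dini_slope_R a (Cmod w) / dini_series_R a (Cmod w)).
Proof.
  intros Hw. set (x := Cmod w). intros Hpos.
  assert (Hx : 0 <= x < B) by (split; [apply Cmod_ge_0 | exact Hw]).
  pose proof (riccati_nonneg mu Hmu t Ht) as Htn.
  assert (Htn' : forall n, 0 <= PS_derive t n) by (intros n; apply Rmult_le_pos; [apply pos_INR | auto]).
  assert (HT : Cmod (cT w) <= PSeries t x) by (apply CPSeries_norm_le; [exact Htn | apply CV_disk_riccati, Hx]).
  assert (HT' : Cmod (cT' w) <= PSeries (PS_derive t) x)
    by (apply CPSeries_norm_le; [exact Htn' | apply CV_disk_derive_riccati, Hx]).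
  assert (HF : 0 < F0 x) by (apply HB, Hx).
  assert (Hden : 0 < 1 - 2 * x * PSeries t x).
  { rewrite dini_series_R_factor // in Hpos.
    apply (Rmult_lt_reg_l (F0 x)); [exact HF | lra]. }
  pose proof (Cmod_ge_0 (cT w)) as HT0. pose proof (Cmod_ge_0 (cT' w)) as HT0'.
  assert (HxT : x * Cmod (cT w) <= x * PSeries t x) by (apply Rmult_le_compat_l; lra).
  assert (HxT' : x * x * Cmod (cT' w) <= x * x * PSeries (PS_derive t) x) by (apply Rmult_le_compat_l; nra).
  assert (E2 : Cmod (RtoC 2) = 2) by (rewrite Cmod_R Rabs_right; lra).
  assert (E4 : Cmod (RtoC 4) = 4) by (rewrite Cmod_R Rabs_right; lra).
  (* The denominator is handled by the reverse triangle inequality. Its lower bound is positive,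
     which at the same time excludes zeros of g' off the real axis. *)
  assert (Hmod : 1 - 2 * x * PSeries t x <= Cmod (1 - 2 * w * cT w)%C).
  { pose proof (Cmod_triangle (1 - 2 * w * cT w)%C (2 * w * cT w)%C) as H.
    replace (1 - 2 * w * cT w + 2 * w * cT w)%C with (RtoC 1) in H by ring.
    rewrite Cmod_1 !Cmod_mult E2 in H. fold x in H. lra. }
  assert (Hne : (1 - 2 * w * cT w)%C <> RtoC 0) by (apply Cmod_gt_0; lra).
  split.
  - rewrite dini_series_factor //. apply Cmult_neq_0; [apply CPSeries_neq_0, Hw | exact Hne].
  - rewrite dini_quotient // dini_quotient_R //; [| lra].
    rewrite Cmod_opp Ropp_involutive.
    eapply Rle_trans; [apply Cmod_triangle |]. rewrite Cmod_div // !Cmod_mult E2 E4. fold x.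
    apply Rplus_le_compat; [lra |].
    unfold Rdiv. apply Rmult_le_compat.
    + apply Rmult_le_pos; [lra | apply Cmod_ge_0].
    + left. apply Rinv_0_lt_compat. lra.
    + apply Rmult_le_compat_l; [lra |].
      eapply Rle_trans; [apply Cmod_triangle |]. rewrite !Cmod_mult. fold x. lra.
    + apply Rinv_le_contravar; [exact Hden | exact Hmod].
Qed.

End Comparison.

(** * Bessel functions as power series *)

Lemma RtoC_neq (x y : R) : x <> y -> RtoC x <> RtoC y.
Proof. intros H E. apply H, RtoC_inj, E. Qed.

(** * Complex exponential and principal powers *)

Lemma Cexp_plus (z w : C) : Cexp (z + w)%C = (Cexp z * Cexp w)%C.
Proof.
  unfold Cexp, Re, Im. apply injective_projections; simpl; rewrite exp_plus ?cos_plus ?sin_plus; ring.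
Qed.

Lemma Cexp_neq_0 (z : C) : Cexp z <> RtoC 0.
Proof.
  intros E. apply C1_nz. transitivity (Cexp (z + - z)).
  - rewrite Cplus_opp_r. unfold Cexp. simpl. rewrite exp_0 cos_0 sin_0.
    apply injective_projections; simpl; ring.
  - rewrite Cexp_plus E. ring.
Qed.

Lemma cos_Carg_sin_Carg (z : C) : z <> RtoC 0 ->
  Cmod z * cos (Carg z) = Re z /\ Cmod z * sin (Carg z) = Im z.
Proof.
  intros Hz. assert (Hm : 0 < Cmod z) by (apply Cmod_gt_0, Hz).
  set (y := Re z / Cmod z).
  assert (Ey : Cmod z * y = Re z) by (unfold y; field; lra).
  assert (Hsq : Cmod z * Cmod z = Re z * Re z + Im z * Im z).
  { unfold Cmod. rewrite sqrt_sqrt; [unfold Re, Im; ring |].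
    pose proof (pow2_ge_0 (fst z)). pose proof (pow2_ge_0 (snd z)). lra. }
  assert (Hy : -1 <= y <= 1).
  { pose proof (Re_le_Cmod z) as H. apply Rabs_le_between in H.
    split; apply (Rmult_le_reg_l (Cmod z)); lra. }
  assert (Hs : Cmod z * sqrt (1 - y²) = Rabs (Im z)).
  { rewrite -(sqrt_Rsqr (Cmod z)); [| lra]. rewrite -sqrt_mult.
    - rewrite -sqrt_Rsqr_abs. f_equal. unfold Rsqr. nra.
    - apply Rle_0_sqr.
    - unfold Rsqr. nra. }
  unfold Carg. fold y. destruct (Rle_dec 0 (Im z)) as [Hi | Hi].
  - rewrite cos_acos // sin_acos // Hs Rabs_right //. lra.
  - rewrite cos_neg sin_neg cos_acos // sin_acos // Ropp_mult_distr_r_reverse Hs Rabs_left //; lra.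
Qed.

Lemma Cexp_Clog (z : C) : z <> RtoC 0 -> Cexp (Clog z) = z.
Proof.
  intros Hz. destruct (cos_Carg_sin_Carg z Hz) as [H1 H2].
  assert (Hm : 0 < Cmod z) by (apply Cmod_gt_0, Hz).
  unfold Cexp, Clog. simpl. rewrite exp_ln // H1 H2. destruct z; reflexivity.
Qed.

Lemma Cpower_Cexp (z : C) (s : R) : z <> RtoC 0 -> Cpower z s = Cexp (RtoC s * Clog z)%C.
Proof. intros Hz. unfold Cpower. destruct (Ceq_dec z 0); [contradiction | reflexivity]. Qed.

Lemma Cpower_plus (z : C) (s s' : R) : z <> RtoC 0 ->
  Cpower z (s + s') = (Cpower z s * Cpower z s')%C.
Proof.
  intros Hz. rewrite !Cpower_Cexp // -Cexp_plus RtoC_plus. f_equal. ring.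
Qed.

Lemma Cpower_neq_0 (z : C) (s : R) : z <> RtoC 0 -> Cpower z s <> RtoC 0.
Proof. intros Hz. rewrite Cpower_Cexp //. apply Cexp_neq_0. Qed.

Lemma Cpower_1 (z : C) : z <> RtoC 0 -> Cpower z 1 = z.
Proof. intros Hz. rewrite Cpower_Cexp // Cmult_1_l. apply Cexp_Clog, Hz. Qed.

Lemma Cpower_INR (z : C) (n : nat) : z <> RtoC 0 -> Cpower z (INR n) = (z ^ n)%C.
Proof.
  intros Hz. induction n as [| n IH].
  - rewrite Cpower_Cexp // Cmult_0_l. unfold Cexp. simpl. rewrite exp_0 cos_0 sin_0.
    apply injective_projections; simpl; ring.
  - rewrite S_INR Cpower_plus // IH Cpower_1 // Cpow_S. ring.
Qed.

Lemma Chalf (z : C) : (z / 2)%C = (Re z / 2, Im z / 2).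
Proof. apply injective_projections; simpl; unfold Re, Im; field. Qed.

Lemma Chalf_neq_0 (z : C) : z <> RtoC 0 -> (z / 2)%C <> RtoC 0.
Proof. intros Hz E. apply Hz. replace z with (2 * (z / 2))%C by (field; apply RtoC_neq; lra). rewrite E. ring. Qed.

(** Division by a positive real leaves the argument unchanged, so the identity holds on the branch
    cut too; this is what lets z^(1-nu) and (z/2)^nu combine to a multiple of z. *)
Lemma Clog_half (z : C) : z <> RtoC 0 -> Clog (z / 2) = (Clog z - ln 2)%C.
Proof.
  intros Hz. assert (Hm : 0 < Cmod z) by (apply Cmod_gt_0, Hz).
  assert (H2 : RtoC 2 <> RtoC 0) by (apply RtoC_neq; lra).
  assert (Em : Cmod (z / 2) = Cmod z / 2) by (rewrite Cmod_div // Cmod_R Rabs_right; lra).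
  assert (Ea : Carg (z / 2) = Carg z).
  { unfold Carg. rewrite Em. rewrite Chalf. simpl Re. simpl Im.
    replace (Re z / 2 / (Cmod z / 2)) with (Re z / Cmod z) by (field; lra).
    destruct (Rle_dec 0 (Im z / 2)), (Rle_dec 0 (Im z)); try reflexivity; lra. }
  unfold Clog. rewrite Em Ea.
  rewrite ln_div; [| lra | lra]. apply injective_projections; simpl; ring.
Qed.

Lemma Cpower_half (z : C) (s : R) : z <> RtoC 0 ->
  Cpower z s = (RtoC (Rpower 2 s) * Cpower (z / 2) s)%C.
Proof.
  intros Hz. rewrite !Cpower_Cexp //; [| apply Chalf_neq_0, Hz]. rewrite Clog_half //.
  replace (RtoC (Rpower 2 s)) with (Cexp (RtoC (s * ln 2))).
  - rewrite -Cexp_plus RtoC_mult. f_equal. ring.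
  - unfold Cexp, Rpower. simpl. rewrite cos_0 sin_0. apply injective_projections; simpl; ring.
Qed.

Lemma Cpower_real (x s : R) : 0 < x -> Cpower (RtoC x) s = RtoC (Rpower x s).
Proof.
  intros Hx. assert (Hne : RtoC x <> RtoC 0) by (apply RtoC_neq; lra).
  rewrite Cpower_Cexp //. unfold Clog, Carg. rewrite Cmod_R Rabs_right; [| lra].
  simpl Re. simpl Im. destruct (Rle_dec 0 0) as [_ | H]; [| lra].
  rewrite Rdiv_diag; [| lra]. rewrite acos_1.
  unfold Cexp, Rpower. simpl. rewrite !Rmult_0_l !Rmult_0_r Rplus_0_r Rminus_0_r cos_0 sin_0.
  apply injective_projections; simpl; ring.
Qed.

(** J_nu without its factor (z/2)^nu, as a series in w = z^2; the powers of 4 come from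
    (z/2)^(2n). *)
Definition bessel_coef (nu : R) (n : nat) : R :=
  (-1) ^ n / (INR (fact n) * Gamma (INR n + nu + 1)) / 4 ^ n.

(** Rescaled to constant term 1: these are the coefficients of F in g_nu(z) = z F(z^2). *)
Definition norm_bessel_coef (nu : R) (n : nat) : R := Gamma (nu + 1) * bessel_coef nu n.

Lemma norm_bessel_coef_0 (nu : R) : -1 < nu -> norm_bessel_coef nu O = 1.
Proof.
  intros Hnu. unfold norm_bessel_coef, bessel_coef. simpl. rewrite Rplus_0_l.
  pose proof (Gamma_pos (nu + 1) ltac:(lra)). field. lra.
Qed.

Lemma norm_bessel_coef_rec (nu : R) (n : nat) : -1 < nu ->
  INR (S n) * (INR n + (nu + 1)) * norm_bessel_coef nu (S n) = - norm_bessel_coef nu n / 4.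
Proof.
  intros Hnu. unfold norm_bessel_coef, bessel_coef.
  pose proof (pos_INR n) as Hn.
  replace (INR (S n) + nu + 1) with (INR n + nu + 1 + 1) by (rewrite S_INR; ring).
  rewrite (Gamma_succ (INR n + nu + 1)); [| lra].
  pose proof (Gamma_pos (INR n + nu + 1) ltac:(lra)) as HG.
  change (fact (S n)) with (S n * fact n)%nat. rewrite mult_INR S_INR.
  pose proof (INR_fact_lt_0 n). simpl pow.
  assert (0 < 4 ^ n) by (apply pow_lt; lra).
  field. repeat split; lra.
Qed.

(** Raising the order by one and shifting the index by one produce the same Gamma factor; the
    derivative cancels n + 1 in the factorial, and the sign and one power of 4 remain. Thus J_(nu+1)
    and J_(nu+2) become F' and F'' up to elementary factors. *)
Lemma PS_derive_bessel_coef (nu : R) (n : nat) : -1 < nu ->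
  bessel_coef (nu + 1) n = - 4 * PS_derive (bessel_coef nu) n.
Proof.
  intros Hnu. unfold PS_derive, bessel_coef.
  pose proof (pos_INR n) as Hn.
  replace (INR n + (nu + 1) + 1) with (INR (S n) + nu + 1) by (rewrite S_INR; ring).
  pose proof (Gamma_pos (INR (S n) + nu + 1) ltac:(rewrite S_INR; lra)) as HG.
  change (fact (S n)) with (S n * fact n)%nat. rewrite mult_INR.
  assert (0 < INR (S n)) by (apply lt_0_INR; lia).
  pose proof (INR_fact_lt_0 n). simpl pow.
  assert (0 < 4 ^ n) by (apply pow_lt; lra).
  field. repeat split; lra.
Qed.

Lemma CV_disk_scal (k : R) (c : nat -> R) (x : R) : CV_disk c x -> CV_disk (fun n => k * c n) x.
Proof.
  intros H. unfold CV_disk. apply (ex_series_ext (fun n => Rabs k * Rabs (c n * x ^ n))).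
  - intros n. rewrite -Rabs_mult Rmult_assoc //.
  - apply (ex_series_scal (V := R_NormedModule) (Rabs k)), H.
Qed.

Lemma CPSeries_scal (k : R) (c : nat -> R) (w : C) : CV_disk c (Cmod w) ->
  CPSeries (fun n => k * c n) w = (RtoC k * CPSeries c w)%C.
Proof.
  intros H. apply is_Cseries_unique.
  eapply is_Cseries_ext; [| apply is_Cseries_scal, CPSeries_correct, H].
  intros n. cbv beta. rewrite RtoC_mult. ring.
Qed.

Lemma entire_norm_bessel_coef (nu : R) : -1 < nu -> entire_coefs (norm_bessel_coef nu).
Proof.
  intros Hnu. apply (entire_bessel_series (nu + 1)); [lra | apply norm_bessel_coef_0, Hnu |].
  intros n. apply norm_bessel_coef_rec, Hnu.
Qed.

Lemma entire_bessel_coef (nu : R) : -1 < nu -> entire_coefs (bessel_coef nu).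
Proof.
  intros Hnu x Hx. pose proof (Gamma_pos (nu + 1) ltac:(lra)).
  replace (bessel_coef nu) with (fun n => / Gamma (nu + 1) * norm_bessel_coef nu n).
  - apply CV_disk_scal, entire_norm_bessel_coef; assumption.
  - apply functional_extensionality. intros n. unfold norm_bessel_coef. field. lra.
Qed.

Lemma bessel_J_CPSeries (nu : R) (z : C) : -1 < nu -> z <> RtoC 0 ->
  bessel_J nu z = (Cpower (z / 2) nu * CPSeries (bessel_coef nu) (z * z))%C.
Proof.
  intros Hnu Hz. assert (Hz2 := Chalf_neq_0 z Hz).
  apply is_Cseries_unique.
  eapply is_Cseries_ext; [| apply is_Cseries_scal, CPSeries_correct, entire_bessel_coef;
    [exact Hnu | apply Cmod_ge_0]].
  intros n. cbv beta. rewrite (Rplus_comm (2 * INR n) nu) Cpower_plus //.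
  replace (2 * INR n) with (INR (2 * n)) by (rewrite mult_INR; simpl; ring).
  rewrite Cpower_INR // Cpow_mult_r.
  unfold bessel_coef. rewrite /Rdiv RtoC_mult.
  assert (H4 : 4 <> 0) by lra.
  replace ((z / 2) ^ 2)%C with (RtoC (/ 4) * (z * z))%C.
  - rewrite (Cpow_mult_l (RtoC (/ 4)) (z * z)) -RtoC_pow pow_inv. ring.
  - apply injective_projections; simpl; field.
Qed.

(** The operator [f] stands for no, one or two formal derivatives, which serve the orders nu, nu + 1
    and nu + 2. *)
Lemma bessel_coef_scal (nu : R) (f : (nat -> R) -> nat -> R) (w : C) : -1 < nu ->
  (forall k c n, f (fun n => k * c n) n = k * f c n) ->
  CV_disk (f (bessel_coef nu)) (Cmod w) ->
  CPSeries (f (bessel_coef nu)) w = (/ RtoC (Gamma (nu + 1)) * CPSeries (f (norm_bessel_coef nu)) w)%C.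
Proof.
  intros Hnu Hf H. pose proof (Gamma_pos (nu + 1) ltac:(lra)).
  rewrite (CPSeries_ext (f (norm_bessel_coef nu)) (fun n => Gamma (nu + 1) * f (bessel_coef nu) n));
    [| intros n; exact (Hf _ (bessel_coef nu) n)].
  rewrite CPSeries_scal //. field. apply RtoC_neq. lra.
Qed.

(** The common nonvanishing factor of J_nu, J_(nu+1), J_(nu+2) and the Dini function; it cancels in
    the equation and does not affect zeros. *)
Definition bessel_prefactor (nu : R) (z : C) : C := (Cpower (z / 2) nu / RtoC (Gamma (nu + 1)))%C.

Lemma bessel_prefactor_neq_0 (nu : R) (z : C) : -1 < nu -> z <> RtoC 0 ->
  bessel_prefactor nu z <> RtoC 0.
Proof.
  intros Hnu Hz. pose proof (Gamma_pos (nu + 1) ltac:(lra)).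
  apply Cmult_neq_0; [apply Cpower_neq_0, Chalf_neq_0, Hz |].
  rewrite -RtoC_inv; [| lra]. apply RtoC_neq, Rinv_neq_0_compat. lra.
Qed.

Lemma bessel_J_series (nu : R) (z : C) : -1 < nu -> z <> RtoC 0 ->
  bessel_J nu z = (bessel_prefactor nu z * CPSeries (norm_bessel_coef nu) (z * z))%C.
Proof.
  intros Hnu Hz. rewrite bessel_J_CPSeries // (bessel_coef_scal nu (fun c => c)) //.
  - unfold bessel_prefactor, Cdiv. ring.
  - apply entire_bessel_coef; [exact Hnu | apply Cmod_ge_0].
Qed.

Lemma bessel_J_succ_series (nu : R) (z : C) : -1 < nu -> z <> RtoC 0 ->
  bessel_J (nu + 1) z
  = (- 2 * z * bessel_prefactor nu z * CPSeries (PS_derive (norm_bessel_coef nu)) (z * z))%C.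
Proof.
  intros Hnu Hz. rewrite bessel_J_CPSeries //; [| lra].
  assert (HD : CV_disk (PS_derive (bessel_coef nu)) (Cmod (z * z))).
  { apply entire_coefs_derive; [apply entire_bessel_coef, Hnu | apply Cmod_ge_0]. }
  rewrite (CPSeries_ext _ (fun n => - 4 * PS_derive (bessel_coef nu) n));
    [| intros; apply PS_derive_bessel_coef, Hnu].
  rewrite CPSeries_scal // (bessel_coef_scal nu PS_derive) //.
  - rewrite Cpower_plus; [| apply Chalf_neq_0, Hz]. rewrite Cpower_1; [| apply Chalf_neq_0, Hz].
    unfold bessel_prefactor. field.
    apply RtoC_neq. pose proof (Gamma_pos (nu + 1) ltac:(lra)). lra.
  - intros; unfold PS_derive; ring.
Qed.

Lemma bessel_J_succ_succ_series (nu : R) (z : C) : -1 < nu -> z <> RtoC 0 ->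
  bessel_J (nu + 2) z
  = (4 * (z * z) * bessel_prefactor nu z
     * CPSeries (PS_derive (PS_derive (norm_bessel_coef nu))) (z * z))%C.
Proof.
  intros Hnu Hz. rewrite bessel_J_CPSeries //; [| lra].
  assert (HD : CV_disk (PS_derive (PS_derive (bessel_coef nu))) (Cmod (z * z))).
  { apply entire_coefs_derive; [apply entire_coefs_derive, entire_bessel_coef, Hnu | apply Cmod_ge_0]. }
  rewrite (CPSeries_ext _ (fun n => 16 * PS_derive (PS_derive (bessel_coef nu)) n)).
  - rewrite CPSeries_scal // (bessel_coef_scal nu (fun c => PS_derive (PS_derive c))) //.
    + rewrite Cpower_plus; [| apply Chalf_neq_0, Hz].
      replace 2 with (INR 2) at 3 by (simpl; ring). rewrite Cpower_INR; [| apply Chalf_neq_0, Hz].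
      unfold bessel_prefactor. simpl Cpow. field.
      apply RtoC_neq. pose proof (Gamma_pos (nu + 1) ltac:(lra)). lra.
    + intros; unfold PS_derive; ring.
  - intros n. replace (nu + 2) with (nu + 1 + 1) by ring.
    rewrite PS_derive_bessel_coef; [| lra]. unfold PS_derive at 1 2.
    rewrite PS_derive_bessel_coef //. ring.
Qed.

Lemma bessel_g_CPSeries (nu : R) : -1 < nu ->
  bessel_g nu = (fun z => z * CPSeries (norm_bessel_coef nu) (z * z))%C.
Proof.
  intros Hnu. apply functional_extensionality. intros z. unfold bessel_g.
  destruct (Ceq_dec z 0) as [-> | Hz]; [rewrite Cmult_0_l // |].
  rewrite bessel_J_series //. unfold bessel_prefactor.
  assert (E : (RtoC (Rpower 2 nu) * Cpower z (1 - nu) * Cpower (z / 2) nu)%C = z).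
  { rewrite -{3}(Cpower_1 z Hz). replace 1 with (1 - nu + nu) at 2 by ring.
    rewrite Cpower_plus // (Cpower_half z nu) //. ring. }
  set (X := CPSeries _ _). rewrite RtoC_mult . rewrite -[in RHS]E. field. apply RtoC_neq.
  pose proof (Gamma_pos (nu + 1) ltac:(lra)). lra.
Qed.

(** * The radius of convexity *)

(* Coquelicot has two non-convertible structures of normed module over C on C itself. *)
Lemma is_derive_C_AbsRing (f : C -> C) (z l : C) :
  is_derive f z l <-> @is_derive C_AbsRing (AbsRing_NormedModule C_AbsRing) f z l.
Proof. split; intros [_ H]; (split; [apply is_linear_scal_l | exact H]). Qed.

Lemma is_derive_Cmult (f g : C -> C) (z df dg : C) :
  is_derive f z df -> is_derive g z dg ->
  is_derive (fun z => f z * g z)%C z (df * g z + f z * dg)%C.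
Proof.
  rewrite !is_derive_C_AbsRing. intros Hf Hg.
  exact (is_derive_mult (K := C_AbsRing) f g z df dg Hf Hg Cmult_comm).
Qed.

Lemma is_derive_Cid (z : C) : is_derive (fun z : C => z) z (RtoC 1).
Proof. apply is_derive_C_AbsRing. exact (is_derive_id (K := C_AbsRing) z). Qed.

Lemma is_derive_Ccomp (f g : C -> C) (z df dg : C) :
  is_derive f (g z) df -> is_derive g z dg -> is_derive (fun z => f (g z)) z (dg * df)%C.
Proof.
  rewrite (is_derive_C_AbsRing g). intros Hf Hg.
  exact (is_derive_comp (K := C_AbsRing) (V := C_NormedModule) f g z df dg Hf Hg).
Qed.

Lemma is_derive_CPSeries_sqr (c : nat -> R) (z : C) : entire_coefs c ->
  is_derive (fun z => CPSeries c (z * z))%C z (2 * z * CPSeries (PS_derive c) (z * z))%C.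
Proof.
  intros Hc. replace (2 * z)%C with (1 * z + z * 1)%C by ring.
  apply (is_derive_Ccomp (CPSeries c) (fun z => z * z)%C); [apply is_derive_CPSeries, Hc |].
  apply (is_derive_Cmult (fun z => z) (fun z => z)); apply is_derive_Cid.
Qed.

(** * Derivatives of z F(z^2) *)

Section Derivatives.

Variable c : nat -> R.
Hypothesis Hc : entire_coefs c.

Lemma is_derive_odd_series (z : C) :
  is_derive (fun z => z * CPSeries c (z * z))%C z (dini_series c (z * z)).
Proof.
  replace (dini_series c (z * z))
    with (1 * CPSeries c (z * z) + z * (2 * z * CPSeries (PS_derive c) (z * z)))%C
    by (unfold dini_series; ring).
  apply (is_derive_Cmult (fun z => z) (fun z => CPSeries c (z * z))%C);
    [apply is_derive_Cid | apply is_derive_CPSeries_sqr, Hc].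
Qed.

(** This is g''. It is odd, hence not a function of z^2, unlike z g'' in [dini_slope]. *)
Definition dini_series_derivative (z : C) : C :=
  (6 * z * CPSeries (PS_derive c) (z * z)
   + 4 * (z * z * z) * CPSeries (PS_derive (PS_derive c)) (z * z))%C.

Lemma is_derive_dini_series (z : C) :
  is_derive (fun z => dini_series c (z * z))%C z (dini_series_derivative z).
Proof.
  replace (dini_series_derivative z)
    with (2 * z * CPSeries (PS_derive c) (z * z)
      + ((0 * (z * z) + 2 * (1 * z + z * 1)) * CPSeries (PS_derive c) (z * z)
         + 2 * (z * z) * (2 * z * CPSeries (PS_derive (PS_derive c)) (z * z))))%C
    by (unfold dini_series_derivative; ring).
  apply (is_derive_plus (V := C_NormedModule) (fun z => CPSeries c (z * z))%C
    (fun z => 2 * (z * z) * CPSeries (PS_derive c) (z * z))%C);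
    [apply is_derive_CPSeries_sqr, Hc |].
  apply (is_derive_Cmult (fun z => 2 * (z * z))%C (fun z => CPSeries (PS_derive c) (z * z))%C);
    [| apply is_derive_CPSeries_sqr, entire_coefs_derive, Hc].
  apply (is_derive_Cmult (fun _ => RtoC 2) (fun z => z * z)%C);
    [apply (is_derive_const (V := C_NormedModule)) |].
  apply (is_derive_Cmult (fun z => z) (fun z => z)); apply is_derive_Cid.
Qed.

(** Analyticity of the convexity quotient requires g'' to be differentiable. *)
Lemma ex_derive_dini_series_derivative (z : C) : ex_derive dini_series_derivative z.
Proof.
  eexists.
  apply (is_derive_plus (V := C_NormedModule) (fun z => 6 * z * CPSeries (PS_derive c) (z * z))%C
    (fun z => 4 * (z * z * z) * CPSeries (PS_derive (PS_derive c)) (z * z))%C).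
  - apply (is_derive_Cmult (fun z => 6 * z)%C (fun z => CPSeries (PS_derive c) (z * z))%C);
      [| apply is_derive_CPSeries_sqr, entire_coefs_derive, Hc].
    apply (is_derive_Cmult (fun _ => RtoC 6) (fun z => z));
      [apply (is_derive_const (V := C_NormedModule)) | apply is_derive_Cid].
  - apply (is_derive_Cmult (fun z => 4 * (z * z * z))%C
      (fun z => CPSeries (PS_derive (PS_derive c)) (z * z))%C);
      [| apply is_derive_CPSeries_sqr, entire_coefs_derive, entire_coefs_derive, Hc].
    apply (is_derive_Cmult (fun _ => RtoC 4) (fun z => z * z * z)%C);
      [apply (is_derive_const (V := C_NormedModule)) |].
    apply (is_derive_Cmult (fun z => z * z)%C (fun z => z)); [| apply is_derive_Cid].
    apply (is_derive_Cmult (fun z => z) (fun z => z)); apply is_derive_Cid.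
Qed.

Let g := fun z => (z * CPSeries c (z * z))%C.

Lemma C_derive_odd_series : C_derive g = fun z => dini_series c (z * z)%C.
Proof.
  apply functional_extensionality. intros z.
  apply is_C_derive_unique, is_derive_odd_series.
Qed.

Lemma convexity_quotient_odd_series :
  convexity_quotient g = fun z => (1 + z * dini_series_derivative z / dini_series c (z * z))%C.
Proof.
  apply functional_extensionality. intros z. unfold convexity_quotient.
  rewrite C_derive_odd_series.
  rewrite (is_C_derive_unique _ _ _ (is_derive_dini_series z)) //.
Qed.

Lemma convexity_quotient_dini (z : C) :
  convexity_quotient g z = (1 + dini_slope c (z * z) / dini_series c (z * z))%C.
Proof.
  rewrite convexity_quotient_odd_series. f_equal. f_equal.
  unfold dini_series_derivative, dini_slope. ring.
Qed.

Lemma convex_of_order_odd_series (alpha r : R) :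
  (forall z, Cmod z < r -> dini_series c (z * z)%C <> RtoC 0) ->
  (forall z, Cmod z < r -> Re (convexity_quotient g z) > alpha) ->
  convex_of_order_on_disk alpha g r.
Proof.
  intros Hne Hre. split; [| split; [| split; [| split; [| exact Hre]]]].
  - intros z _. eexists. apply is_derive_odd_series.
  - rewrite C_derive_odd_series. intros z _. eexists. apply is_derive_dini_series.
  - rewrite C_derive_odd_series. exact Hne.
  - rewrite convexity_quotient_odd_series. intros z Hz.
    destruct (ex_derive_dini_series_derivative z) as [l Hl].
    eexists. apply (is_derive_plus (V := C_NormedModule) (fun _ => RtoC 1)
      (fun z => z * dini_series_derivative z / dini_series c (z * z))%C);
      [apply (is_derive_const (V := C_NormedModule)) |].
    apply (is_derive_Cmult (fun z => z * dini_series_derivative z)%C (fun z => / dini_series c (z * z))%C).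
    + apply (is_derive_Cmult (fun z => z) dini_series_derivative); [apply is_derive_Cid | exact Hl].
    + apply (is_derive_Ccomp Cinv (fun z => dini_series c (z * z))%C);
        [apply is_derive_Cinv, Hne, Hz | apply is_derive_dini_series].
Qed.

Lemma is_derive_PSeries_sqr (d : nat -> R) (x : R) : entire_coefs d ->
  is_derive (fun x => PSeries d (x * x)) x (2 * x * PSeries (PS_derive d) (x * x)).
Proof.
  intros Hd. apply (is_derive_comp (PSeries d) (fun x => x * x));
    [apply is_derive_PSeries, entire_coefs_radius, Hd |].
  auto_derive; [trivial | ring].
Qed.

Lemma is_derive_odd_series_R (x : R) :
  is_derive (fun x => x * PSeries c (x * x)) x (dini_series_R c (x * x)).
Proof.
  replace (dini_series_R c (x * x))
    with (1 * PSeries c (x * x) + x * (2 * x * PSeries (PS_derive c) (x * x)))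
    by (unfold dini_series_R; ring).
  apply (is_derive_mult (K := R_AbsRing) (fun x => x) (fun x => PSeries c (x * x)));
    [apply (is_derive_id (K := R_AbsRing)) | apply is_derive_PSeries_sqr, Hc | apply Rmult_comm].
Qed.

Lemma is_derive_dini_series_R (x : R) :
  is_derive (fun x => dini_series_R c (x * x)) x
    (6 * x * PSeries (PS_derive c) (x * x) + 4 * (x * x * x) * PSeries (PS_derive (PS_derive c)) (x * x)).
Proof.
  replace (6 * x * PSeries (PS_derive c) (x * x) + 4 * (x * x * x) * PSeries (PS_derive (PS_derive c)) (x * x))
    with (2 * x * PSeries (PS_derive c) (x * x)
      + (4 * x * PSeries (PS_derive c) (x * x)
         + 2 * (x * x) * (2 * x * PSeries (PS_derive (PS_derive c)) (x * x)))) by ring.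
  apply (is_derive_plus (V := R_NormedModule) (fun x => PSeries c (x * x))
    (fun x => 2 * (x * x) * PSeries (PS_derive c) (x * x))); [apply is_derive_PSeries_sqr, Hc |].
  apply (is_derive_mult (K := R_AbsRing) (fun x => 2 * (x * x)) (fun x => PSeries (PS_derive c) (x * x)));
    [| apply is_derive_PSeries_sqr, entire_coefs_derive, Hc | apply Rmult_comm].
  auto_derive; [trivial | ring].
Qed.

Lemma is_derive_mul_dini_series_R (x : R) :
  is_derive (fun x => x * dini_series_R c (x * x)) x (dini_series_R c (x * x) + dini_slope_R c (x * x)).
Proof.
  replace (dini_series_R c (x * x) + dini_slope_R c (x * x))
    with (1 * dini_series_R c (x * x) + x * (6 * x * PSeries (PS_derive c) (x * x)
      + 4 * (x * x * x) * PSeries (PS_derive (PS_derive c)) (x * x)))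
    by (unfold dini_slope_R; ring).
  apply (is_derive_mult (K := R_AbsRing) (fun x => x) (fun x => dini_series_R c (x * x)));
    [apply (is_derive_id (K := R_AbsRing)) | apply is_derive_dini_series_R | apply Rmult_comm].
Qed.

Lemma continuous_PSeries_sqr (d : nat -> R) (x : R) : entire_coefs d ->
  continuous (fun x => PSeries d (x * x)) x.
Proof.
  intros Hd. apply (ex_derive_continuous (fun x => PSeries d (x * x))).
  eexists. apply is_derive_PSeries_sqr, Hd.
Qed.

End Derivatives.

(** [C_derive] takes its limits along the horizontal line through the point, which for a real point
    is the real axis. Hence the derivative of J_nu inside the Dini function can be computed with
    real powers. *)
Lemma C_derive_real (f : C -> C) (g : R -> R) (x l : R) :
  locally x (fun s => f (RtoC s) = RtoC (g s)) -> is_derive g x l ->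
  C_derive f (RtoC x) = RtoC l.
Proof.
  intros Hf Hg. apply is_derive_Reals in Hg.
  assert (Hq : locally' x (fun s => ((f (RtoC s) - f (RtoC x)) / (RtoC s - RtoC x))%C
                                 = RtoC ((g s - g x) / (s - x)))).
  { assert (Hx := locally_singleton _ _ Hf).
    unfold locally', within. apply: filter_imp Hf => s Hs Hne.
    rewrite Hs Hx RtoC_div; [| lra]. rewrite !RtoC_minus //. }
  unfold C_derive, C_lim. simpl fst at 2. simpl snd at 1.
  apply injective_projections; simpl fst; simpl snd.
  - rewrite (is_lim_unique _ x l) //.
    apply (is_lim_ext_loc (fun s => (g s - g x) / (s - x))).
    + apply: filter_imp Hq => s Hs. rewrite [LHS](_ : _ = fst (RtoC ((g s - g x) / (s - x)))) //.
      rewrite -Hs //.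
    + apply is_lim_spec. intros eps. destruct (Hg eps (cond_pos eps)) as [d Hd].
      exists d. intros s Hs Hne.
      assert (Hs' : Rabs (s - x) < d) by exact Hs.
      specialize (Hd (s - x) ltac:(lra) Hs').
      rewrite Rplus_minus in Hd. exact Hd.
  - rewrite (is_lim_unique _ x 0) //.
    apply (is_lim_ext_loc (fun _ => 0)); [| apply is_lim_const].
    apply: filter_imp Hq => s Hs.
    rewrite [LHS](_ : _ = snd (RtoC ((g s - g x) / (s - x)))) // -Hs //.
Qed.

(** The derivative of the prefactor is nu / x times the prefactor; multiplied by x it cancels the
    term - nu J_nu of the Dini function. *)
Lemma dini_eq_series (nu x : R) : -1 < nu -> 0 < x ->
  dini nu (RtoC x)
  = (bessel_prefactor nu (RtoC x) * dini_series (norm_bessel_coef nu) (RtoC x * RtoC x))%C.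
Proof.
  intros Hnu Hx.
  set (c := norm_bessel_coef nu). pose proof (entire_norm_bessel_coef nu Hnu) as Hc. fold c in Hc.
  pose proof (Gamma_pos (nu + 1) ltac:(lra)) as HG.
  set (p := fun s => Rpower (s / 2) nu / Gamma (nu + 1)).
  assert (Hp : forall s, 0 < s -> bessel_prefactor nu (RtoC s) = RtoC (p s)).
  { intros s Hs. unfold bessel_prefactor, p. rewrite -RtoC_div; [| lra].
    rewrite Cpower_real; [| lra]. rewrite -RtoC_div; [reflexivity | lra]. }
  assert (HJ : forall s, 0 < s -> bessel_J nu (RtoC s) = RtoC (p s * PSeries c (s * s))).
  { intros s Hs. rewrite bessel_J_series //; [| apply RtoC_neq; lra].
    rewrite Hp // -RtoC_mult CPSeries_real -RtoC_mult //. }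
  assert (HD : C_derive (bessel_J nu) (RtoC x)
    = RtoC (nu / x * p x * PSeries c (x * x) + p x * (2 * x * PSeries (PS_derive c) (x * x)))).
  { apply (C_derive_real _ (fun s => p s * PSeries c (s * s))).
    - exists (mkposreal x Hx). intros s Hs. apply HJ.
      assert (H : Rabs (s - x) < x) by exact Hs. apply Rabs_def2 in H. lra.
    - apply (is_derive_mult (K := R_AbsRing) p (fun s => PSeries c (s * s)));
        [| apply is_derive_PSeries_sqr, Hc | apply Rmult_comm].
      unfold p, Rpower, Rdiv. auto_derive; [lra |]. field. lra. }
  unfold dini. rewrite HD HJ // Hp // -(RtoC_mult x x) dini_series_real. unfold dini_series_R.
  rewrite -!RtoC_mult -RtoC_plus. f_equal. field. lra.
Qed.

(** The denominator J_nu - x J_(nu+1) is the prefactor times g'(x), and x times the numerator is the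
    prefactor times x g''(x). *)
Lemma convexity_equation_series (nu alpha x : R) : -1 < nu -> 0 < x ->
  convexity_equation nu alpha x <->
  dini_series_R (norm_bessel_coef nu) (x * x) <> 0 /\
  1 + dini_slope_R (norm_bessel_coef nu) (x * x) / dini_series_R (norm_bessel_coef nu) (x * x) = alpha.
Proof.
  intros Hnu Hx. set (c := norm_bessel_coef nu).
  assert (Hx0 : RtoC x <> RtoC 0) by (apply RtoC_neq; lra).
  pose proof (bessel_prefactor_neq_0 nu (RtoC x) Hnu Hx0) as HP.
  unfold convexity_equation.
  rewrite bessel_J_series // bessel_J_succ_series // bessel_J_succ_succ_series //. fold c.
  set (P := bessel_prefactor nu (RtoC x)) in *.
  set (f0 := CPSeries c _). set (f1 := CPSeries (PS_derive c) _).
  set (f2 := CPSeries (PS_derive (PS_derive c)) _).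
  replace (P * f0 - RtoC x * (- 2 * RtoC x * P * f1))%C
    with (P * dini_series c (RtoC x * RtoC x))%C by (unfold dini_series, f0, f1; ring).
  rewrite -(RtoC_mult x x) dini_series_real.
  set (D := dini_series_R c (x * x)).
  assert (E : D <> 0 -> (1 + RtoC x * ((RtoC x * (4 * RtoC (x * x) * P * f2) - 3 * (- 2 * RtoC x * P * f1))
      / (P * RtoC D)))%C = RtoC (1 + dini_slope_R c (x * x) / D)).
  { intros HD. rewrite RtoC_plus RtoC_div // -dini_slope_real. f_equal.
    unfold dini_slope. rewrite RtoC_mult. fold f1 f2. field.
    split; [apply RtoC_neq, HD | exact HP]. }
  split.
  - intros [H1 H2]. assert (HD : D <> 0) by (intros HD0; apply H1; rewrite HD0; ring).
    split; [exact HD |]. apply RtoC_inj. rewrite -E; [exact H2 | exact HD].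
  - intros [HD H2]. split; [apply Cmult_neq_0; [exact HP | apply RtoC_neq, HD] |].
    rewrite E // H2 //.
Qed.

(** If F were positive everywhere, the comparison would hold with every [B]; one more than the bound
    of [first_zero_bound] is already contradictory. *)
Lemma bessel_series_nonpos (nu : R) : -1 < nu -> exists X, 0 < X /\ PSeries (norm_bessel_coef nu) X <= 0.
Proof.
  intros Hnu. apply NNPP. intros Hn.
  destruct (ex_riccati (nu + 1) ltac:(lra)) as [t Ht].
  assert (H : 4 * (nu + 1) * (1 + (nu + 1)) + 1 <= 4 * (nu + 1) * (1 + (nu + 1))); [| lra].
  apply (first_zero_bound (nu + 1) (norm_bessel_coef nu) t); try assumption; try lra.
  - apply norm_bessel_coef_0, Hnu.
  - intros n. apply norm_bessel_coef_rec, Hnu.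
  - intros x [[Hx | <-] _].
    + apply Rnot_le_lt. intros Hle. apply Hn. eauto.
    + rewrite PSeries_0 norm_bessel_coef_0; lra.
Qed.

Lemma rolle (f f' : R -> R) (a b : R) : a < b -> (forall x, is_derive f x (f' x)) -> f a = f b ->
  exists c, a < c < b /\ f' c = 0.
Proof.
  intros Hab Hf E. destruct (MVT_cor2 f f' a b Hab) as [c [Hc Hcab]].
  - intros x _. apply is_derive_Reals, Hf.
  - exists c. split; [exact Hcab |]. rewrite E Rminus_diag in Hc.
    destruct (Rmult_integral _ _ (eq_sym Hc)); lra.
Qed.

Theorem theorem2 (nu alpha : R) (hnu : -1 < nu) (halpha : 0 <= alpha < 1) :
  exists r a j : R,
    radius_of_convexity alpha (bessel_g nu) = Finite r /\
    smallest_positive (convexity_equation nu alpha) r /\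
    smallest_positive (fun x => dini nu (RtoC x) = RtoC 0) a /\
    smallest_positive (fun x => bessel_J nu (RtoC x) = RtoC 0) j /\
    r < a /\ a < j.
Proof.
  set (c := norm_bessel_coef nu).
  assert (Hc := entire_norm_bessel_coef nu hnu). fold c in Hc.
  assert (Hc1 := entire_coefs_derive c Hc). assert (Hc2 := entire_coefs_derive _ Hc1).
  assert (Hc0 : c O = 1) by apply norm_bessel_coef_0, hnu.
  assert (Hrec : forall n, INR (S n) * (INR n + (nu + 1)) * c (S n) = - c n / 4)
    by (intros n; apply norm_bessel_coef_rec, hnu).
  assert (H00 : PSeries c (0 * 0) = 1) by (rewrite Rmult_0_l PSeries_0 //).
  destruct (bessel_series_nonpos nu hnu) as [X [HX HcX]]. fold c in HcX.
  destruct (first_zero (fun x => PSeries c (x * x)) (sqrt X)) as [j [Hj [Ej Hjpos]]].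
  { intros x. apply continuous_PSeries_sqr, Hc. }
  { apply sqrt_lt_R0, HX. }
  { cbv beta. rewrite H00. lra. }
  { cbv beta. rewrite sqrt_sqrt; lra. }
  (* The Rolle points [a1] and [r1] are only right ends for the search of the first zeros; being
     interior, they make the inequalities r < a < j strict. *)
  destruct (rolle _ _ 0 j ltac:(lra) (is_derive_odd_series_R c Hc)) as [a1 [Ha1 Ea1]].
  { rewrite Ej. ring. }
  destruct (first_zero (fun x => dini_series_R c (x * x)) a1) as [a [Ha [Ea Hapos]]].
  { intros x. apply (ex_derive_continuous (fun x => dini_series_R c (x * x))).
    eexists. apply is_derive_dini_series_R, Hc. }
  { lra. }
  { cbv beta. unfold dini_series_R. rewrite H00. lra. }
  { cbv beta. lra. }
  destruct (rolle _ _ 0 a ltac:(lra) (is_derive_mul_dini_series_R c Hc)) as [r1 [Hr1 Er1]].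
  { rewrite Ea. ring. }
  (* The equation cleared of its denominator: h = (1 - alpha) g' + z g''. It equals 1 - alpha > 0 at
     0. At [r1], where g' + z g'' = 0 and g' > 0, it equals - alpha g', which is nonpositive because
     alpha >= 0. *)
  set (h := fun x => (1 - alpha) * dini_series_R c (x * x) + dini_slope_R c (x * x)).
  destruct (first_zero h r1) as [r [Hr [Er Hrpos]]].
  { intros x. apply (ex_derive_continuous h).
    assert (Hd : forall d y, entire_coefs d -> ex_derive (PSeries d) y).
    { intros d y Hd. eexists. apply is_derive_PSeries, entire_coefs_radius, Hd. }
    unfold h, dini_series_R, dini_slope_R.
    auto_derive; repeat split; auto. }
  { lra. }
  { unfold h, dini_series_R, dini_slope_R. rewrite H00. lra. }
  { unfold h. assert (0 < dini_series_R c (r1 * r1)) by (apply Hapos; lra).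
    assert (0 <= alpha * dini_series_R c (r1 * r1)) by (apply Rmult_le_pos; lra). lra. }
  assert (Hdr : forall x, 0 <= x <= r -> 0 < dini_series_R c (x * x)) by (intros x Hx; apply Hapos; lra).
  (* Clearing the denominator is justified by g' > 0 on [0, r]; for minimality only roots below r
     have to be excluded. *)
  assert (Heq : forall x, 0 < x <= r -> (convexity_equation nu alpha x <-> h x = 0)).
  { intros x Hx. rewrite convexity_equation_series //; [| lra]. fold c.
    specialize (Hdr x ltac:(lra)).
    assert (E : 1 + dini_slope_R c (x * x) / dini_series_R c (x * x) - alpha = h x / dini_series_R c (x * x))
      by (unfold h; field; lra).
    split.
    - intros [_ H]. rewrite H Rminus_diag in E.
      replace (h x) with (h x / dini_series_R c (x * x) * dini_series_R c (x * x)) by (field; lra).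
      rewrite -E. ring.
    - intros H. split; [lra |]. rewrite H in E. unfold Rdiv at 2 in E. lra. }
  exists r, a, j. split; [| split; [| split; [| split; [| lra]]]].
  - rewrite bessel_g_CPSeries //. fold c.
    apply is_lub_Rbar_unique. split.
    (* A larger disk would contain the real point r, where the quotient equals alpha, against the
       strict inequality. *)
    + intros r' [Hr' Hconv]. simpl. apply Rnot_lt_le. intros Hlt.
      destruct Hconv as [_ [_ [_ [_ Hre]]]].
      assert (Hmod : Cmod (RtoC r) = r) by (rewrite Cmod_R Rabs_right; lra).
      specialize (Hre (RtoC r) ltac:(lra)).
      rewrite convexity_quotient_dini // -RtoC_mult dini_slope_real dini_series_real in Hre.
      pose proof (proj2 (Heq r ltac:(lra)) Er) as H.
      apply convexity_equation_series in H; [| exact hnu | lra]. fold c in H. destruct H as [H1 H2].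
      rewrite -RtoC_div // -RtoC_plus H2 re_RtoC in Hre. lra.
    (* The disk is open, so r itself is admissible and every upper bound is at least r. *)
    + intros l Hl. apply Hl. split; [lra |].
      destruct (ex_riccati (nu + 1) ltac:(lra)) as [t Ht].
      destruct (ex_inverse_series t) as [b Hb].
      (* In the variable w = z^2 the first zero of F lies at j^2, which is the [B] of the
         comparison. *)
      assert (HB : forall w, 0 <= w < j * j -> 0 < PSeries c w).
      { intros w Hw. rewrite -(sqrt_sqrt w); [| lra]. apply Hjpos.
        split; [apply sqrt_pos |]. rewrite -(sqrt_square j); [| lra]. apply sqrt_lt_1; lra. }
      assert (Hbound : forall z, Cmod z < r -> dini_series c (z * z)%C <> RtoC 0 /\
        Cmod (dini_slope c (z * z) / dini_series c (z * z))%C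
        <= - (dini_slope_R c (Cmod z * Cmod z) / dini_series_R c (Cmod z * Cmod z))).
      { intros z Hz. pose proof (Cmod_ge_0 z) as Hz0. rewrite -Cmod_mult.
        apply (dini_quotient_bound (nu + 1) c t b ltac:(lra) Hc0 Hrec Ht Hb (j * j) HB).
        - rewrite Cmod_mult. nra.
        - rewrite Cmod_mult. apply Hdr. lra. }
      apply convex_of_order_odd_series; [exact Hc | intros z Hz; apply Hbound, Hz |].
      intros z Hz. destruct (Hbound z Hz) as [_ Hb1]. pose proof (Cmod_ge_0 z) as Hz0.
      rewrite convexity_quotient_dini //.
      set (q := (dini_slope c (z * z) / dini_series c (z * z))%C) in *.
      change (1 + Re q > alpha).
      (* With D and S the values of g' and z g'' at |z|: 1 + Re q >= 1 - |q| >= 1 + S / D = alpha +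
         h / D > alpha. *)
      pose proof (Re_le_Cmod q) as Hq. apply Rabs_le_between in Hq.
      specialize (Hrpos (Cmod z) ltac:(lra)). specialize (Hdr (Cmod z) ltac:(lra)).
      set (D := dini_series_R c (Cmod z * Cmod z)) in *.
      assert (E : 1 + dini_slope_R c (Cmod z * Cmod z) / D - alpha = h (Cmod z) / D)
        by (unfold h; fold D; field; lra).
      assert (0 < h (Cmod z) / D) by (apply Rdiv_lt_0_compat; assumption).
      lra.
  - split; [lra |]. split; [apply Heq; [lra | exact Er] |].
    intros s Hs Hseq. apply Rnot_lt_le. intros Hlt.
    apply Heq in Hseq; [| lra]. specialize (Hrpos s ltac:(lra)). lra.
  - assert (Hdini : forall s, 0 < s -> (dini nu (RtoC s) = RtoC 0 <-> dini_series_R c (s * s) = 0)).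
    { intros s Hs. rewrite dini_eq_series // -RtoC_mult dini_series_real. fold c.
      split; [| intros ->; ring]. intros E. apply NNPP. intros Hne.
      revert E. apply Cmult_neq_0; [| apply RtoC_neq, Hne].
      apply bessel_prefactor_neq_0; [exact hnu | apply RtoC_neq; lra]. }
    split; [lra |]. split; [apply Hdini; [lra | exact Ea] |].
    intros s Hs E. apply Rnot_lt_le. intros Hlt. apply Hdini in E; [| exact Hs].
    specialize (Hapos s ltac:(lra)). lra.
  - assert (HJ : forall s, 0 < s -> (bessel_J nu (RtoC s) = RtoC 0 <-> PSeries c (s * s) = 0)).
    { intros s Hs. assert (Hs0 : RtoC s <> RtoC 0) by (apply RtoC_neq; lra).
      rewrite bessel_J_series // -RtoC_mult CPSeries_real. fold c.
      split; [| intros ->; ring]. intros E. apply NNPP. intros Hne.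
      revert E. apply Cmult_neq_0; [| apply RtoC_neq, Hne].
      apply bessel_prefactor_neq_0; assumption. }
    split; [lra |]. split; [apply HJ; [lra | exact Ej] |].
    intros s Hs E. apply Rnot_lt_le. intros Hlt. apply HJ in E; [| exact Hs].
    specialize (Hjpos s ltac:(lra)). lra.
Qed.
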